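(* Let $n$ be a positive integer and let $\Lambda$ be a basic minimal $n$-Auslander-Gorenstein algebra. Then an injective $\Lambda$-module $I$ is projective if and only if the Gorenstein projective dimension of its socle is at most $n$; that is, $$\mathrm{prinj}(\Lambda)=\{I\in\Lambda\text{-mod}\mid I\text{ is injective and }\mathrm{Gpd}(\mathrm{soc}\,I)\le n\}.$$
   Context: All modules are finitely generated left modules; $\Lambda\text{-mod}$ is the category of finitely generated left $\Lambda$-modules. For a minimal injective coresolution $0\to\Lambda\to I_0\to I_1\to\cdots$ of the left regular module, the dominant dimension $\mathrm{domdim}\,\Lambda$ is the supremum of the integers $d\ge 0$ such that $I_j$ is projective for all $0\le j<d$. An Artin algebra $\Lambda$ is a minimal $n$-Auslander-Gorenstein algebra if $\mathrm{id}\,{}_\Lambda\Lambda\le n+1\le\mathrm{domdim}\,\Lambda$, where $\mathrm{id}$ is injective dimension. $\mathrm{prinj}(\Lambda)$ is the full subcategory of $\Lambda\text{-mod}$ of modules that are both projective and injective. $\mathrm{soc}$ denotes the socle. $\mathrm{Gpd}$ denotes the Gorenstein projective dimension: a module is Gorenstein projective if it is a syzygy (image of a differential) of an exact complex of finitely generated projective modules that stays exact after applying $\mathrm{Hom}_\Lambda(-,\Lambda)$, and $\mathrm{Gpd}\,N$ is the minimal length of a resolution of $N$ by Gorenstein projective modules ($\infty$ if no finite one exists); the zero module is regarded as having $\mathrm{Gpd}\le n$. *)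

(* Defs.v *)
From HB Require Import structures.
From mathcomp Require Import all_boot all_order all_algebra.
From mathcomp Require Import boolp.

Set Implicit Arguments.
Unset Strict Implicit.
Unset Printing Implicit Defensive.

Import GRing.Theory.
Local Open Scope ring_scope.

(* The rings below are of type pzRingType, so that the zero ring is allowed.
   A left R-module is an lmodType R; R^o is R as a left module over itself.
   A submodule is a submodClosed subset of a module; its membership is
   boolean, which is no restriction in the classical logic of boolp. *)

Section Modules.
Variable R : pzRingType.
Implicit Types U V W M N P I A B : lmodType R.

Definition fin_gen M : Prop :=
  exists (m : nat) (g : 'I_m -> M),
    forall x, exists c : 'I_m -> R, x = \sum_i c i *: g i.

Definition exact_at U V W (f : U -> V) (g : V -> W) : Prop :=
  forall y, g y = 0 <-> exists x, f x = y.

Definition surjective U V (f : U -> V) : Prop := forall y, exists x, f x = y.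

Definition zero_mod M : Prop := forall x : M, x = 0.

Definition isomorphic M N : Prop := exists f : {linear M -> N}, bijective f.

(* Projectivity and injectivity are taken in the category of finitely
   generated modules. *)
Definition projective_mod P : Prop :=
  forall A B (f : {linear A -> B}) (g : {linear P -> B}),
    fin_gen A -> fin_gen B -> surjective f ->
    exists h : {linear P -> A}, forall x, f (h x) = g x.

Definition injective_mod I : Prop :=
  forall A B (f : {linear A -> B}) (g : {linear A -> I}),
    fin_gen A -> fin_gen B -> injective f ->
    exists h : {linear B -> I}, forall x, h (f x) = g x.

Definition prinj M : Prop :=
  [/\ fin_gen M, projective_mod M & injective_mod M].

End Modules.

Section Submodules.
Variables (R : pzRingType) (V : lmodType R).

Definition submod (S : submodClosed V) : Type := {x : V | x \in S}.

Section Instances.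
Variable S : submodClosed V.
HB.instance Definition _ := SubChoice.on (submod S).
HB.instance Definition _ := [SubChoice_isSubLmodule of submod S by <:].
End Instances.

Definition simple_submod (S : submodClosed V) : Prop :=
  (exists2 x, x \in S & x != 0) /\
  forall T : submodClosed V, {subset T <= S} ->
    (forall x, x \in T -> x = 0) \/ {subset S <= T}.

Definition in_some_simple (x : V) : Prop :=
  exists2 S : submodClosed V, simple_submod S & x \in S.

Definition in_socle (x : V) : Prop :=
  exists2 s : seq V, x = \sum_(v <- s) v & {in s, forall v, in_some_simple v}.

Definition socle : pred V := fun x => `[< in_socle x >].

Fact socle_submod_closed : submod_closed socle.
Proof.
have in_soc x : reflect (in_socle x) (x \in socle) by exact: asboolP.
split=> [|a x y /in_soc[s -> sS] /in_soc[t -> tS]]; apply/in_soc.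
  by exists [::]; rewrite ?big_nil.
exists ([seq a *: v | v <- s] ++ t).
  by rewrite big_cat big_map scaler_sumr.
move=> v; rewrite mem_cat => /orP[/mapP[u us ->]|/tS //].
by have [S Ssimple uS] := sS u us; exists S; rewrite ?rpredZ.
Qed.

HB.instance Definition _ :=
  GRing.isSubmodClosed.Build R V socle socle_submod_closed.

Definition indecomposable : Prop :=
  (exists x : V, x != 0) /\
  forall S T : submodClosed V,
    (forall x, x \in S -> x \in T -> x = 0) ->
    (forall x, exists s t, [/\ s \in S, t \in T & x = s + t]) ->
    (forall x, x \in S -> x = 0) \/ (forall x, x \in T -> x = 0).

Definition direct_decomposition (m : nat) (S : 'I_m -> submodClosed V) : Prop :=
  (forall x, exists2 p : 'I_m -> V, forall i, p i \in S i & x = \sum_i p i) /\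
  (forall p : 'I_m -> V, (forall i, p i \in S i) ->
     \sum_i p i = 0 -> forall i, p i = 0).

End Submodules.

Definition soc (R : pzRingType) (M : lmodType R) : lmodType R :=
  submod (GRing.SubmodClosed.clone R M (@socle R M) _).

Section Homological.
Variable R : pzRingType.
Implicit Types M N : lmodType R.

Definition essential_image (U V : lmodType R) (f : U -> V) : Prop :=
  forall S : submodClosed V, (forall u, f u \in S -> f u = 0) ->
    forall y, y \in S -> y = 0.

Definition injective_coresolution M (I : nat -> lmodType R)
    (e : {linear M -> I 0%N}) (d : forall j, {linear I j -> I j.+1}) : Prop :=
  [/\ forall j, fin_gen (I j) /\ injective_mod (I j), injective e,
      exact_at e (d 0%N) & forall j, exact_at (d j) (d j.+1)].

(* I 0 is an injective envelope of M, and I j.+1 is one of the cokernel of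
   the preceding map, which d j identifies with its own image. *)
Definition minimal_injective_coresolution M (I : nat -> lmodType R)
    (e : {linear M -> I 0%N}) (d : forall j, {linear I j -> I j.+1}) : Prop :=
  [/\ injective_coresolution e d, essential_image e
    & forall j, essential_image (d j)].

Definition injdim_le M (m : nat) : Prop :=
  exists (I : nat -> lmodType R) (e : {linear M -> I 0%N})
         (d : forall j, {linear I j -> I j.+1}),
    injective_coresolution e d /\ (forall j, (m < j)%N -> zero_mod (I j)).

(* m <= domdim R; minimal injective coresolutions are unique up to
   isomorphism. *)
Definition domdim_ge (m : nat) : Prop :=
  exists (I : nat -> lmodType R) (e : {linear R^o -> I 0%N})
         (d : forall j, {linear I j -> I j.+1}),
    minimal_injective_coresolution e d /\
    (forall j, (j < m)%N -> projective_mod (I j)).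

(* Exactness is required at all P (i + 1), where i ranges over int, hence
   everywhere. *)
Definition totally_acyclic (P : int -> lmodType R)
    (d : forall i, {linear P i -> P (i + 1)}) : Prop :=
  [/\ forall i, fin_gen (P i) /\ projective_mod (P i),
      forall i, exact_at (d i) (d (i + 1))
    & forall i (g : {linear P (i + 1) -> R^o}),
        (forall x, g (d i x) = 0) <->
        exists h : {linear P (i + 1 + 1) -> R^o},
          forall y, h (d (i + 1) y) = g y].

Definition gorenstein_projective M : Prop :=
  exists (P : int -> lmodType R) (d : forall i, {linear P i -> P (i + 1)}),
    totally_acyclic d /\
    exists (i : int) (f : {linear M -> P (i + 1)}),
      injective f /\ forall y, (exists x, f x = y) <-> (exists x, d i x = y).

Definition Gpd_le N (m : nat) : Prop :=
  exists (G : nat -> lmodType R) (e : {linear G 0%N -> N})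
         (d : forall j, {linear G j.+1 -> G j}),
    [/\ forall j, gorenstein_projective (G j), surjective e,
        exact_at (d 0%N) e, forall j, exact_at (d j.+1) (d j)
      & forall j, (m < j)%N -> zero_mod (G j)].

End Homological.

Section Algebras.

Definition artinian (k : comPzRingType) : Prop :=
  forall J : nat -> submodClosed k^o,
    (forall i, {subset J i.+1 <= J i}) ->
    exists m, forall i, (m <= i)%N -> J i =i J m.

(* The structure map phi is used instead of an algType k, which would
   exclude the zero algebra. *)
Definition artin_algebra (R : pzRingType) : Prop :=
  exists (k : comPzRingType) (phi : {rmorphism k -> R}),
    [/\ artinian k, forall a x, GRing.comm (phi a) x
      & exists (m : nat) (g : 'I_m -> R),
          forall x, exists c : 'I_m -> k, x = \sum_i phi (c i) * g i].

Definition basic_algebra (R : pzRingType) : Prop :=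
  exists (m : nat) (P : 'I_m -> submodClosed R^o),
    [/\ direct_decomposition P, forall i, indecomposable (submod (P i))
      & forall i j, isomorphic (submod (P i)) (submod (P j)) -> i = j].

Definition minimal_Auslander_Gorenstein (R : pzRingType) (n : nat) : Prop :=
  [/\ artin_algebra R, injdim_le R^o n.+1 & domdim_ge R n.+1].

End Algebras.

(* Main.v *)
From HB Require Import structures.
Require Import Defs.
From mathcomp Require Import all_boot all_order all_algebra.
From mathcomp Require Import ring_quotient boolp classical_sets.

(* Let 0 -> R -> I_0 -> ... -> I_n -> J -> 0 be the minimal injective
   coresolution of R, with I_0, ..., I_n projective.  Then Ext^(n+1)(X, R) = 0
   means that every map X -> J lifts to I_n.

   Every simple module embeds in a projective-injective module or in J.  There
   are as many simple modules as indecomposable projectives P_i, and P_i is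
   sent to the top of a simple submodule of P_i if P_i is injective, and of the
   (n+1)-st cosyzygy of P_i otherwise.  This assignment is injective: maps
   between cosyzygies lift to maps between the P_i, uniquely up to maps that
   factor through projective-injectives, while an endomorphism of J factoring
   through I_n -> J is nilpotent because the kernel of I_n -> J is essential.

   Hence X embeds in a projective-injective module as soon as
   Ext^(n+1)(X, R) = 0: an embedding in J of a simple submodule S of X extends
   to X, and the lift to I_n of this extension is injective on S.  For
   X = soc I, this gives one implication, as Gpd X <= n forces
   Ext^(n+1)(X, R) = 0.  It also shows that a module X with Ext^t(X, R) = 0 for
   all t > 0 is Gorenstein projective, since the cokernel of a left
   approximation of X by free modules inherits the condition.  Conversely, if
   I is projective and injective, a map soc I -> J extends to I and then lifts
   to I_n, so the n-th syzygy of soc I is Gorenstein projective. *)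

Set Implicit Arguments.
Unset Strict Implicit.
Unset Printing Implicit Defensive.

Import GRing.Theory.
Local Open Scope quotient_scope.
Local Open Scope ring_scope.

(** * Submodules, quotients and linear maps *)

Section LinearMaps.
Variable R : pzRingType.
Implicit Types U V W X : lmodType R.

Lemma linear_of U V (f : U -> V) :
  linear f -> exists g : {linear U -> V}, forall x, g x = f x.
Proof.
move=> flin.
pose g : {linear U -> V} :=
  HB.pack f (GRing.isLinear.Build R U V *:%R f flin).
by exists g.
Qed.

(** Submodules are [Prop]-valued predicates in the proofs; [mk_sub] turns one into the boolean
    [submodClosed] of the definitions. *)
Definition is_submod V (S : V -> Prop) : Prop :=
  S 0 /\ forall a x y, S x -> S y -> S (a *: x + y).

Definition asboolS V (S : V -> Prop) & is_submod S : pred V := fun x => `[< S x >].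

Fact asboolS_closed V (S : V -> Prop) (hS : is_submod S) :
  submod_closed (asboolS hS).
Proof.
case: (hS) => S0 Sl; split=> [|a x y /asboolP Sx /asboolP Sy]; apply/asboolP => //.
exact: Sl.
Qed.

HB.instance Definition _ V (S : V -> Prop) (hS : is_submod S) :=
  GRing.isSubmodClosed.Build R V (asboolS hS) (asboolS_closed hS).

Definition mk_sub V (S : V -> Prop) (hS : is_submod S) : submodClosed V :=
  GRing.SubmodClosed.clone R V (asboolS hS) _.

Lemma mk_subP V (S : V -> Prop) (hS : is_submod S) x : x \in mk_sub hS <-> S x.
Proof. by split=> /asboolP. Qed.

Lemma is_submodP V (S : submodClosed V) : is_submod (fun x => x \in S).
Proof. by split=> [|a x y Sx Sy]; [apply: rpred0|rewrite rpredD ?rpredZ]. Qed.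

Section SubmodTheory.
Variables (V : lmodType R) (S : V -> Prop).
Hypothesis hS : is_submod S.

Lemma sub0 : S 0. Proof. by case: hS. Qed.
Lemma subD x y : S x -> S y -> S (x + y).
Proof. by case: hS => _ + Sx Sy => /(_ 1 _ _ Sx Sy); rewrite scale1r. Qed.
Lemma subZ a x : S x -> S (a *: x).
Proof. by case: hS => S0 + Sx => /(_ a _ _ Sx S0); rewrite addr0. Qed.
Lemma subN x : S x -> S (- x).
Proof. by move=> /(subZ (-1)); rewrite scaleN1r. Qed.
Lemma subB x y : S x -> S y -> S (x - y).
Proof. by move=> Sx /subN; apply: subD. Qed.

Lemma submodule_ex : exists U (i : {linear U -> V}),
  injective i /\ forall v, S v <-> exists u, i u = v.
Proof.
pose T := mk_sub hS.
have [i iE] : exists i : {linear submod T -> V}, forall x, i x = val x.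
  exact: linear_of.
exists (submod T : lmodType R), i; split=> [x y|v]; first by rewrite !iE => /val_inj.
split=> [Sv|[u <-]]; last by rewrite iE; apply/(mk_subP hS)/valP.
have Tv : v \in T by apply/mk_subP.
by exists (Sub v Tv); rewrite iE SubK.
Qed.

Lemma quotient_ex : exists W (p : {linear V -> W}),
  surjective p /\ forall v, p v = 0 <-> S v.
Proof.
pose T : submodClosed V := mk_sub hS.
pose Q := Quotient.quot T.
(* The additive quotient gets its scalar action through representatives; [scpi] shows that their
   choice does not matter. *)
pose sc (a : R) (x : Q) : Q := \pi_Q (a *: repr x).
have piE x y : \pi_Q x = \pi_Q y :> Q <-> S (x - y).
  split=> [/eqP|Sxy]; first by rewrite -Quotient.idealrBE => /mk_subP.
  by apply/eqP; rewrite -Quotient.idealrBE; apply/mk_subP.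
have scpi a x : sc a (\pi_Q x) = \pi_Q (a *: x).
  by apply/piE; rewrite -scalerBr; apply: subZ; apply/piE; rewrite reprK.
have scA a b v : sc a (sc b v) = sc (a * b) v.
  by rewrite -[v]reprK !scpi scalerA !reprK.
have sc1 : left_id 1 sc by move=> v; rewrite -[v]reprK scpi scale1r.
have scDr : right_distributive sc +%R.
  by move=> a x y; rewrite -[x]reprK -[y]reprK -raddfD !scpi scalerDr raddfD.
have scDl v : {morph sc^~ v : a b / a + b}.
  by move=> a b; rewrite -[v]reprK !scpi scalerDl raddfD.
pose W : lmodType R := HB.pack Q (GRing.Zmodule_isLmodule.Build R Q scA sc1 scDr scDl).
have [p pE] : exists p : {linear V -> W}, forall x, p x = \pi_Q x.
  apply: (@linear_of V W (fun x => \pi_Q x)) => a x y.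
  by rewrite raddfD; congr (_ + _); apply: esym; apply: scpi.
exists W, p; split=> [y|v].
  by exists (repr (y : Q)); rewrite pE reprK.
rewrite pE; have -> : (0 : W) = \pi_Q 0 by rewrite -pE raddf0.
by rewrite piE subr0.
Qed.

End SubmodTheory.

Lemma ker_submod U V (f : {linear U -> V}) : is_submod (fun x => f x = 0).
Proof.
by split=> [|a x y fx fy]; rewrite ?raddf0 // linearP fx fy scaler0 addr0.
Qed.

Lemma im_submod U V (f : {linear U -> V}) : is_submod (fun y => exists x, f x = y).
Proof.
split=> [|a _ _ [x <-] [y <-]]; first by exists 0; rewrite raddf0.
by exists (a *: x + y); rewrite linearP.
Qed.

Lemma inj_ker0 U V (f : {linear U -> V}) :
  (forall x, f x = 0 -> x = 0) -> injective f.
Proof.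
by move=> f0 x y fxy; apply/eqP; rewrite -subr_eq0; apply/eqP/f0; rewrite linearB fxy subrr.
Qed.

Lemma linear_lift U V X (i : {linear U -> V}) (g : {linear X -> V}) :
  injective i -> (forall x, exists u, i u = g x) ->
  exists h : {linear X -> U}, forall x, i (h x) = g x.
Proof.
move=> i_inj /choice[h hE].
have [|h' h'E] := @linear_of X U h.
  by move=> a x y; apply: i_inj; rewrite hE !linearP !hE.
by exists h' => x; rewrite h'E.
Qed.

Lemma linear_factor V W X (p : {linear V -> W}) (g : {linear V -> X}) :
  surjective p -> (forall v, p v = 0 -> g v = 0) ->
  exists h : {linear W -> X}, forall v, h (p v) = g v.
Proof.
move=> /choice[s sE] g0.
have gE u v : p u = p v -> g u = g v.
  move=> puv; apply/eqP; rewrite -subr_eq0 -linearB; apply/eqP/g0.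
  by rewrite linearB puv subrr.
have [|h hE] := @linear_of W X (fun w => g (s w)).
  by move=> a x y; rewrite -linearP; apply: gE; rewrite linearP !sE.
by exists h => v; rewrite hE; apply: gE; rewrite sE.
Qed.

Lemma linear_inv U V (f : {linear U -> V}) : bijective f ->
  exists g : {linear V -> U}, cancel f g /\ cancel g f.
Proof.
case=> g fK gK; have [|g' g'E] := @linear_of V U g.
  by move=> a x y; apply: (can_inj fK); rewrite linearP !gK.
by exists g'; split=> x; rewrite g'E.
Qed.

Lemma inj_surj_bij U V (f : U -> V) : injective f -> surjective f -> bijective f.
Proof. by move=> fi /choice[g gE]; exists g => // x; apply: fi; rewrite gE. Qed.

Definition ses U V W (i : {linear U -> V}) (p : {linear V -> W}) : Prop :=
  [/\ injective i, surjective p & exact_at i p].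

Lemma ses_ker V W (p : {linear V -> W}) : surjective p ->
  exists U (i : {linear U -> V}), ses i p.
Proof.
move=> ps; have [U [i [i_inj iE]]] := submodule_ex (ker_submod p).
by exists U, i; split.
Qed.

Lemma ses_coker U V (i : {linear U -> V}) : injective i ->
  exists W (p : {linear V -> W}), ses i p.
Proof.
move=> i_inj; have [W [p [ps pE]]] := quotient_ex (im_submod i).
by exists W, p; split.
Qed.

Lemma fin_gen_im V W (p : {linear V -> W}) : surjective p -> fin_gen V -> fin_gen W.
Proof.
move=> ps [m [g gV]]; exists m, (fun i => p (g i)) => w.
have [v <-] := ps w; have [c ->] := gV v; exists c.
by rewrite linear_sum; apply: eq_bigr => i _; rewrite linearZ.
Qed.

Lemma free_map V (m : nat) (g : 'I_m -> V) :
  exists f : {linear 'rV[R]_m -> V}, forall x, f x = \sum_i x 0 i *: g i.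
Proof.
apply: linear_of => a x y; rewrite scaler_sumr -big_split.
by apply: eq_bigr => i _; rewrite !mxE scalerDl scalerA.
Qed.

Lemma free_fg (m : nat) : fin_gen 'rV[R]_m.
Proof. by exists m, (delta_mx 0) => x; exists (x 0); apply: row_sum_delta. Qed.

Lemma free_proj (m : nat) : projective_mod 'rV[R]_m.
Proof.
move=> A B f g _ _ fs.
have [s sE] := choice (fun i => fs (g (delta_mx 0 i))).
have [h hE] := free_map s; exists h => x.
rewrite hE linear_sum [in RHS](row_sum_delta x) linear_sum.
by apply: eq_bigr => i _; rewrite !linearZ sE.
Qed.

Lemma free_cover V : fin_gen V ->
  exists m (p : {linear 'rV[R]_m -> V}), surjective p.
Proof.
move=> [m [g gV]]; have [p pE] := free_map g; exists m, p => v.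
have [c ->] := gV v; exists (\row_i c i); rewrite pE.
by apply: eq_bigr => i _; rewrite mxE.
Qed.

Lemma reg_fg : fin_gen R^o.
Proof.
by exists 1%N, (fun _ => 1) => x; exists (fun _ => x); rewrite big_ord1 [_ *: _]mulr1.
Qed.

Lemma reg_map V (v : V) : exists f : {linear R^o -> V}, forall x, f x = (x : R) *: v.
Proof. by apply: linear_of => a x y; rewrite scalerDl scalerA. Qed.

Lemma reg_proj : projective_mod R^o.
Proof.
move=> A B f g _ _ fs; have [a aE] := fs (g 1); have [h hE] := reg_map a.
by exists h => x; rewrite hE linearZ aE -linearZ [_ *: _]mulr1.
Qed.

Definition retract U V : Prop :=
  exists (i : {linear U -> V}) (r : {linear V -> U}), cancel i r.

Lemma retract_fg U V : retract U V -> fin_gen V -> fin_gen U.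
Proof. by case=> i [r irK]; apply: (fin_gen_im (p := r)) => y; exists (i y). Qed.

Lemma retract_proj U V : retract U V -> projective_mod V -> projective_mod U.
Proof.
move=> [i [r irK]] pV A B f g fA fB fs.
have [h hE] := pV A B f (g \o r) fA fB fs.
by exists (h \o i) => x /=; rewrite hE /= irK.
Qed.

Lemma retract_inj U V : retract U V -> injective_mod V -> injective_mod U.
Proof.
move=> [i [r irK]] iV A B f g fA fB fi.
have [h hE] := iV A B f (i \o g) fA fB fi.
by exists (r \o h) => x /=; rewrite hE /= irK.
Qed.

Lemma retract_prinj U V : retract U V -> prinj V -> prinj U.
Proof.
move=> rUV [fV pV iV]; split.
- exact: retract_fg rUV fV.
- exact: retract_proj rUV pV.
- exact: retract_inj rUV iV.
Qed.

Section Product.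
Variables U V : lmodType R.

Lemma inl_linear : exists i : {linear U -> (U * V)%type}, forall x, i x = (x, 0).
Proof. by apply: linear_of => a x y; congr pair; rewrite /= ?scaler0 ?addr0. Qed.

Lemma inr_linear : exists j : {linear V -> (U * V)%type}, forall x, j x = (0, x).
Proof. by apply: linear_of => a x y; congr pair; rewrite /= ?scaler0 ?addr0. Qed.

Lemma pairing X (f : {linear X -> U}) (g : {linear X -> V}) :
  exists h : {linear X -> (U * V)%type}, forall x, h x = (f x, g x).
Proof. by apply: linear_of => a x y; rewrite !linearP. Qed.

Lemma prinj_prod : prinj U -> prinj V -> prinj (U * V)%type.
Proof.
move=> [[m [g gU]] pU iU] [[k [h hV]] pV iV].
have [[i iE] [j jE]] := (inl_linear, inr_linear).
split.
- exists (m + k)%N, (fun l => match split l with inl a => i (g a) | inr b => j (h b) end).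
  move=> [u v]; have [c ->] := gU u; have [d ->] := hV v.
  exists (fun l => match split l with inl a => c a | inr b => d b end).
  rewrite big_split_ord /=.
  have sl a : split (lshift k a) = inl a by exact: (unsplitK (inl a)).
  have sr b : split (rshift m b) = inr b by exact: (unsplitK (inr b)).
  rewrite [X in _ = X + _](eq_bigr (fun a => i (c a *: g a))); last first.
    by move=> a _; rewrite sl linearZ.
  rewrite [X in _ = _ + X](eq_bigr (fun b => j (d b *: h b))); last first.
    by move=> b _; rewrite sr linearZ.
  rewrite -!linear_sum iE jE; congr pair; rewrite /= ?addr0 ?add0r //.
- move=> A B f g' fA fB fs.
  have [a aE] := pU A B f (g' \o i) fA fB fs.
  have [b bE] := pV A B f (g' \o j) fA fB fs.
  have [|q qE] := @linear_of (U * V)%type A (fun x => a x.1 + b x.2).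
    by move=> c x y; rewrite /= !linearP addrACA scalerDr.
  exists q => -[u v]; rewrite qE linearD aE bE /= iE jE -linearD.
  by congr (g' (_, _)); rewrite /= ?addr0 ?add0r.
- move=> A B f g' fA fB fs.
  have [a aE] := iU A B f (fst \o g') fA fB fs.
  have [b bE] := iV A B f (snd \o g') fA fB fs.
  have [q qE] := pairing a b.
  by exists q => x; rewrite qE aE bE /=; case: (g' x).
Qed.

End Product.
End LinearMaps.

(** * Artinian commutative rings have finite length *)

Definition incl T (S S' : T -> Prop) : Prop := forall x, S x -> S' x.

Section ArtinianBase.
Variable k : comPzRingType.
Hypothesis k_artin : artinian k.
Implicit Types I S T C : k^o -> Prop.

Lemma artinian_min (F : (k^o -> Prop) -> Prop) :
  (forall S, F S -> is_submod S) -> (exists S, F S) ->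
  exists S, F S /\ forall T, F T -> incl T S -> incl S T.
Proof.
move=> Fsub [S0 FS0]; apply: contrapT => nomin.
have step (X : {S | F S}) : exists Y : {S | F S},
    incl (sval Y) (sval X) /\ ~ incl (sval X) (sval Y).
  case: X => S FS /=; apply: contrapT => noY; apply: nomin; exists S.
  split=> // T FT TS; apply: contrapT => nST.
  by apply: noY; exists (exist _ T FT).
have [next nextP] := choice step.
pose X n := iter n next (exist _ S0 FS0).
have XS n := Fsub _ (svalP (X n)).
have [m mP] : exists m, forall i, (m <= i)%N -> mk_sub (XS i) =i mk_sub (XS m).
  apply: k_artin => i x /mk_subP Xx; apply/mk_subP; move: Xx => /=.
  exact: (nextP _).1.
case: (nextP (X m)) => _; apply=> x Xx.
by have /mk_subP : x \in mk_sub (XS m.+1) by rewrite mP //; apply/mk_subP.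
Qed.

(** Finite length is encoded by a strictly monotone function from submodules to natural numbers, in
    place of composition series. *)
Definition ideal_flen I : Prop := exists mu : (k^o -> Prop) -> nat,
  forall S T, is_submod S -> is_submod T -> incl S T -> incl T I ->
    (mu S <= mu T)%N /\ ((mu T <= mu S)%N -> incl T S).

Definition meet S T : k^o -> Prop := fun x => S x /\ T x.
Definition mulS (a : k) S : k^o -> Prop := fun y => exists2 x, S x & y = a * x.
Definition annS (a : k) : k^o -> Prop := fun x => a * x = 0.

Lemma meet_sub S T : is_submod S -> is_submod T -> is_submod (meet S T).
Proof.
move=> [S0 hS] [T0 hT]; split=> // a x y [Sx Tx] [Sy Ty].
by split; [apply: hS|apply: hT].
Qed.

Lemma mulS_sub a S : is_submod S -> is_submod (mulS a S).
Proof.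
move=> [S0 hS]; split=> [|c _ _ [x Sx ->] [y Sy ->]]; first by exists 0; rewrite ?mulr0.
exists (c *: x + y); first exact: hS.
by rewrite mulrDr mulrCA.
Qed.

Lemma annS_sub a : is_submod (annS a).
Proof.
split=> [|c x y ax ay]; first exact: mulr0.
by rewrite /annS mulrDr ay addr0 mulrCA ax mulr0.
Qed.

(** Lengths add up along multiplication by [a], which maps [I] onto [mulS a I] with kernel
    [meet I (annS a)]. *)
Lemma flen_mul a I : is_submod I -> ideal_flen (meet I (annS a)) ->
  ideal_flen (mulS a I) -> ideal_flen I.
Proof.
move=> hI [m1 m1P] [m2 m2P].
exists (fun S => m1 (meet S (annS a)) + m2 (mulS a S))%N => S T hS hT ST TI.
have [le1 eq1] : (m1 (meet S (annS a)) <= m1 (meet T (annS a)))%N /\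
    ((m1 (meet T (annS a)) <= m1 (meet S (annS a)))%N ->
     incl (meet T (annS a)) (meet S (annS a))).
  apply: m1P.
  - exact: meet_sub hS (annS_sub a).
  - exact: meet_sub hT (annS_sub a).
  - by move=> x [/ST].
  - by move=> x [/TI].
have [le2 eq2] : (m2 (mulS a S) <= m2 (mulS a T))%N /\
    ((m2 (mulS a T) <= m2 (mulS a S))%N -> incl (mulS a T) (mulS a S)).
  apply: m2P.
  - exact: mulS_sub.
  - exact: mulS_sub.
  - by move=> _ [x Sx ->]; exists x => //; apply: ST.
  - by move=> _ [x Tx ->]; exists x => //; apply: TI.
split=> [|le12 x Tx]; first exact: leq_add.
have {}eq1 : incl (meet T (annS a)) (meet S (annS a)).
  by apply: eq1; rewrite -(leq_add2r (m2 (mulS a S))) (leq_trans _ le12) ?leq_add2l.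
have {}eq2 : incl (mulS a T) (mulS a S).
  by apply: eq2; rewrite -(leq_add2l (m1 (meet S (annS a)))) (leq_trans _ le12) ?leq_add2r.
have [|y Sy axy] := eq2 (a * x); first by exists x.
have [|Sxy _] := eq1 (x - y).
  split; first by apply: (subB hT) => //; exact: ST.
  by rewrite /annS mulrBr axy subrr.
by rewrite -[x](subrK y); apply: (subD hS).
Qed.

Lemma artinian_absorb (a : k) : exists n (b : k), a ^+ n = a ^+ n.+1 * b.
Proof.
pose J n : k^o -> Prop := mulS (a ^+ n) (fun=> True).
have hJ n : is_submod (J n) by apply: mulS_sub.
have [||_ [[n ->] minJ]] := @artinian_min (fun S => exists n, S = J n).
- by move=> _ [n ->]; apply: hJ.
- by exists (J 0%N), 0%N.
have JJ : incl (J n.+1) (J n).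
  by move=> _ [x _ ->]; exists (a * x) => //; rewrite exprSr mulrA.
have [|b _ ab] := minJ (J n.+1) (ex_intro _ n.+1 erefl) JJ (a ^+ n).
  by exists 1 => //; rewrite mulr1.
by exists n, b.
Qed.

(* An ideal I minimal among those of infinite length is a vector space over
   the field k / ann I; a hyperplane C of I has finite length by minimality,
   hence so has I. *)
Lemma artinian_flen : ideal_flen (fun=> True).
Proof.
apply: contrapT => ninf.
pose F S := is_submod S /\ ~ ideal_flen S.
have [||I [[hI Ninf] Imin]] := @artinian_min F.
- by move=> S [].
- by exists (fun=> True); split.
have small S : is_submod S -> incl S I -> ~ incl I S -> ideal_flen S.
  by move=> hS SI nIS; apply: contrapT => nfS; apply: nIS; apply: Imin.
have [x0 Ix0 x0N0] : exists2 x, I x & x <> 0.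
  apply: contrapT => I0; apply: Ninf; exists (fun=> 0%N) => S T hS hT ST TI.
  split=> // _ x /TI Ix; suff -> : x = 0 by case: hS.
  by apply: contrapT => xN0; apply: I0; exists x.
(* Otherwise the kernel and the image of [a] on [I] are both proper submodules of [I], hence of
   finite length, and so would be [I]. *)
have dich (a : k) : (forall x, I x -> a * x = 0) \/ incl I (mulS a I).
  apply: contrapT => /not_orP[na nI]; apply: Ninf; apply: (@flen_mul a) => //.
    apply: small; [exact: meet_sub hI (annS_sub a)|by move=> x []|].
    by move=> IA; apply: na => x /IA[].
  apply: small => //; first exact: mulS_sub.
  by move=> _ [x Ix ->]; apply: (subZ hI).
have inv (a : k) : ~ (forall x, I x -> a * x = 0) ->
    exists b, forall x, I x -> b * (a * x) = x.
  move=> na; have IaI : incl I (mulS a I) by case: (dich a).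
  (* [1 - a * b] kills [mulS (a ^+ n) I], which is all of [I]. *)
  have [n [b abE]] := artinian_absorb a; exists b => x Ix.
  have kill y : I y -> a ^+ n * ((1 - a * b) * y) = 0.
    by move=> Iy; rewrite mulrA mulrBr mulr1 mulrA -exprSr -abE subrr mul0r.
  have surj m : incl I (mulS (a ^+ m) I).
    elim: m => [|m IHm] y Iy; first by exists y => //; rewrite mul1r.
    have [z Iz ->] := IaI y Iy; have [t It ->] := IHm z Iz.
    by exists t => //; rewrite mulrA exprS.
  have {kill} : (1 - a * b) * x = 0.
    have [t It ->] := surj n x Ix.
    by rewrite mulrCA kill.
  by rewrite mulrBl mul1r => /eqP; rewrite subr_eq0 => /eqP; rewrite mulrA [b * a]mulrC.
(* The hyperplane [C] is taken maximal among the submodules of [I] avoiding [x0]. *)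
pose P (C : set k) := (forall c y z, C y -> C z -> C (c * y + z)) /\
  (C `<=` (I : set k))%classic /\ ~ C x0.
have [|C [[Cl [CI Cx0]] Cmax]] := @Zorn_bigcup k P.
  move=> Fam FP Ftot; split=> [c y z [A FA Ay] [B FB Bz]|].
    have [AB|BA] := Ftot _ _ FA FB.
      by exists B => //; apply: (FP _ FB).1 => //; apply: AB.
    by exists A => //; apply: (FP _ FA).1 => //; apply: BA.
  split=> [y [A FA Ay]|[A FA Ay]]; first exact: ((FP _ FA).2).1 Ay.
  by case: ((FP _ FA).2) => _ /(_ Ay).
have hC : is_submod (C : k^o -> Prop).
  split=> [|a x y Cx Cy]; last exact: Cl.
  (* The empty set also satisfies [P], but it is not maximal, being strictly contained in the zero
     submodule. *)
  apply: contrapT => C0; apply: (Cmax [set 0]%classic).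
    have C_0 : C = classical_sets.set0.
      apply/seteqP; split=> // x Cx; apply: C0.
      by rewrite -(subrr x) -[_ - _]addrC -mulN1r; apply: Cl.
    rewrite C_0; split=> [x //|/(_ 0 erefl)//].
  split=> [c _ _ -> ->|]; first by rewrite mulr0 addr0.
  by split=> [_ ->|/esym]; [case: hI|move=> ?; apply: x0N0].
have decomp y : I y -> exists c (a : k), C c /\ y = c + a * x0.
  move=> Iy; have [Cy|nCy] := EM (C y).
    by exists y, 0; rewrite mul0r addr0.
  (* By maximality of [C], the larger submodule [D] contains [x0]; the coefficient of [y] acts
     invertibly on [I], so [y] can be solved for. *)
  pose D : set k := fun z => exists c (a : k), C c /\ z = c + a * y.
  have [c [a [Cc x0E]]] : D x0.
    apply: contrapT => nDx; apply: (Cmax D).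
      split=> [z Cz|DC]; first by exists z, 0; rewrite mul0r addr0.
      apply: nCy; apply: DC; exists 0, 1; rewrite mul1r add0r.
      by split=> //; case: hC.
    split=> [e _ _ [c [a [Cc ->]]] [c' [a' [Cc' ->]]]|].
      exists (e * c + c'), (e * a + a'); split; first exact: Cl.
      by rewrite mulrDr mulrDl addrACA mulrA.
    split=> // _ [c [a [Cc ->]]]; apply: (subD hI); first exact: CI.
    exact: (subZ hI (a : k)).
  have [b bE] : exists b, forall x, I x -> b * (a * x) = x.
    apply: inv => a0; apply: Cx0; move: x0E.
    by rewrite (a0 _ Iy) addr0 => ->.
  exists (- (b * c)), b; split.
    by apply: (subN hC); apply: (subZ hC (b : k)).
  by rewrite x0E mulrDr bE // addKr.
have [mu muP] : ideal_flen C.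
  by apply: small => // IC; apply: Cx0; apply: IC.
apply: Ninf.
(* The quotient of [I] by [C] has length at most 1, so the second summand only records whether [S]
   leaves [C]. *)
exists (fun S => mu (meet S C) + `[< ~ incl S C >])%N => S T hS hT ST TI.
have [le1 eq1] : (mu (meet S C) <= mu (meet T C))%N /\
    ((mu (meet T C) <= mu (meet S C))%N -> incl (meet T C) (meet S C)).
  apply: muP.
  - exact: meet_sub.
  - exact: meet_sub.
  - by move=> x [/ST].
  - by move=> x [].
have le2 : (`[< ~ incl S C >] <= `[< ~ incl T C >])%N.
  case: (asboolP (~ incl S C)) => //= nSC.
  by rewrite lt0b; apply/asboolP => TC; apply: nSC => x /ST/TC.
split=> [|le12 x Tx]; first exact: leq_add.
have {}eq1 : incl (meet T C) (meet S C).
  by apply: eq1; rewrite -(leq_add2r `[< ~ incl S C >]) (leq_trans _ le12) ?leq_add2l.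
have eq2 : (`[< ~ incl T C >] <= `[< ~ incl S C >])%N.
  by rewrite -(leq_add2l (mu (meet S C))) (leq_trans _ le12) ?leq_add2r.
have [TC|nTC] := EM (incl T C).
  by have [] := eq1 x (conj Tx (TC _ Tx)).
have /existsNP[t /not_implyP[St nCt]] : ~ incl S C.
  by move: eq2; rewrite (asboolT nTC) lt0b => /asboolP.
have [c [a [Cc tE]]] := decomp t (TI _ (ST _ St)).
have [c' [a' [Cc' xE]]] := decomp x (TI _ Tx).
have [b bE] : exists b, forall x, I x -> b * (a * x) = x.
  by apply: inv => a0; apply: nCt; rewrite tE a0 // addr0.
(* This multiple of [t] has the same [x0]-component as [x], so their difference lies in [C]. *)
have tE' : (a' * b) * t = a' * b * c + a' * x0.
  by rewrite tE mulrDr -[a' * b * (a * x0)]mulrA bE.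
have Sx' : S ((a' * b) * t) by apply: (subZ hS (a' * b : k)).
have [|Sd _] := eq1 (x - (a' * b) * t).
  split; first by apply: (subB hT) => //; apply: ST.
  rewrite tE' xE opprD addrACA subrr addr0; apply: (subB hC) => //.
  exact: (subZ hC (a' * b : k)).
by rewrite -[x](subrK ((a' * b) * t)); apply: (subD hS).
Qed.

End ArtinianBase.

(** * Finitely generated modules over an Artin algebra *)

Lemma nat_argmax (T : Type) (P : T -> Prop) (f : T -> nat) (M : nat) :
  (exists x, P x) -> (forall x, P x -> (f x <= M)%N) ->
  exists x, P x /\ forall y, P y -> (f y <= f x)%N.
Proof.
move=> [x0 Px0] fM.
have exQ : exists n, `[< exists2 x, P x & f x = n >].
  by exists (f x0); apply/asboolP; exists x0.
have [|_ /asboolP[x Px <-] maxx] := @ex_maxnP _ M exQ.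
  by move=> _ /asboolP[x Px <-]; apply: fM.
by exists x; split=> // y Py; apply: maxx; apply/asboolP; exists y.
Qed.

Section ScalarRestriction.
Variables (k : comPzRingType) (R : pzRingType) (phi : {rmorphism k -> R}).
Implicit Types V W : lmodType R.

Definition ksub V (S : V -> Prop) : Prop :=
  S 0 /\ forall a x y, S x -> S y -> S (phi a *: x + y).

Lemma is_submod_ksub V (S : V -> Prop) : is_submod S -> ksub S.
Proof. by move=> [S0 hS]; split=> // a x y; apply: hS. Qed.

Lemma ksubD V (S : V -> Prop) x y : ksub S -> S x -> S y -> S (x + y).
Proof. by move=> [_ hS] Sx Sy; have := hS 1 _ _ Sx Sy; rewrite rmorph1 scale1r. Qed.

Lemma ksubB V (S : V -> Prop) x y : ksub S -> S x -> S y -> S (x - y).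
Proof.
move=> [_ hS] Sx Sy; have := hS (-1) _ _ Sy Sx.
by rewrite rmorphN rmorph1 scaleN1r addrC.
Qed.

Definition kcomb V r (v : 'I_r -> V) (c : 'I_r -> k) : V := \sum_i phi (c i) *: v i.

Definition kspan V r (v : 'I_r -> V) (x : V) : Prop := exists c, x = kcomb v c.

Lemma kcombP V r (v : 'I_r -> V) a (c d : 'I_r -> k) :
  kcomb v (fun i => a * c i + d i) = phi a *: kcomb v c + kcomb v d.
Proof.
rewrite /kcomb scaler_sumr -big_split; apply: eq_bigr => i _.
by rewrite rmorphD rmorphM scalerDl scalerA.
Qed.

Lemma kcomb0 V r (v : 'I_r -> V) : kcomb v (fun=> 0) = 0.
Proof. by rewrite /kcomb big1 // => i _; rewrite rmorph0 scale0r. Qed.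

Lemma kspan_sub V r (v : 'I_r -> V) : ksub (kspan v).
Proof.
split=> [|a _ _ [c ->] [d ->]]; first by exists (fun=> 0); rewrite kcomb0.
by exists (fun i => a * c i + d i); rewrite kcombP.
Qed.

Definition has_klength V : Prop := exists mu : (V -> Prop) -> nat,
  forall S T, ksub S -> ksub T -> incl S T ->
    (mu S <= mu T)%N /\ ((mu T <= mu S)%N -> incl T S).

(* The length of S is the sum of the lengths of its ideals of leading
   coefficients with respect to the generators v. *)
Lemma kspan_klength V r (v : 'I_r -> V) :
  artinian k -> (forall x, kspan v x) -> has_klength V.
Proof.
move=> /artinian_flen[mu muP] vV.
pose J S (l : 'I_r) : k^o -> Prop := fun a => exists c : 'I_r -> k,
  [/\ c l = a, forall j : 'I_r, (l < j)%N -> c j = 0 & S (kcomb v c)].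
have hJ S l : ksub S -> is_submod (J S l).
  move=> [S0 hS]; split=> [|a _ _ [c [<- c0 Sc]] [d [<- d0 Sd]]].
    by exists (fun=> 0); rewrite kcomb0; split.
  exists (fun i => a * c i + d i); rewrite kcombP; split=> //.
    by move=> j lj; rewrite c0 // d0 // mulr0 addr0.
  exact: hS.
exists (fun S => \sum_l mu (J S l))%N => S T hS hT ST.
have JST l : incl (J S l) (J T l).
  by move=> _ [c [<- c0 Sc]]; exists c; split=> //; apply: ST.
have [le1 eq1] := (fun l => (muP _ _ (hJ S l hS) (hJ T l hT) (JST l) (fun _ _ => Logic.I)).1,
  fun l => (muP _ _ (hJ S l hS) (hJ T l hT) (JST l) (fun _ _ => Logic.I)).2).
split=> [|le12 x Tx]; first by apply: leq_sum => l _; apply: le1.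
have {}eq1 l : incl (J T l) (J S l).
  apply: eq1; rewrite leqNgt; apply/negP => lt12.
  move: le12; rewrite (bigD1 l) //= [leqRHS](bigD1 l) //= leqNgt => /negP; apply.
  by rewrite -addSn leq_add // leq_sum.
(* Induction on the number of generators involved: an element of [S] with the same leading
   coefficient is subtracted. *)
have main m : (m <= r)%N -> forall c : 'I_r -> k,
    (forall j : 'I_r, (m <= j)%N -> c j = 0) -> T (kcomb v c) -> S (kcomb v c).
  elim: m => [_ c c0 _|m IHm mr c c0 Tc].
    have -> : kcomb v c = kcomb v (fun=> 0).
      by rewrite /kcomb; apply: eq_bigr => j _; rewrite c0.
    by rewrite kcomb0; case: hS.
  pose l := Ordinal mr.
  have [|d [dl d0 Sd]] := eq1 l (c l).
    by exists c; split=> // j lj; rewrite c0.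
  have cE : kcomb v (fun i => (-1) * d i + c i) = kcomb v c - kcomb v d.
    by rewrite kcombP rmorphN rmorph1 scaleN1r addrC.
  rewrite -[kcomb v c](subrK (kcomb v d)) -cE; apply: ksubD => //.
  apply: IHm; first exact: ltnW.
    move=> j; rewrite leq_eqVlt => /orP[/eqP mj|mj]; last first.
      by rewrite d0 // c0 // mulr0 addr0.
    have -> : j = l by apply: val_inj.
    by rewrite dl mulN1r addNr.
  by rewrite cE; apply: ksubB => //; apply: ST.
have [c xE] := vV x; rewrite xE in Tx *.
by apply: (main r) => // j; rewrite leqNgt ltn_ord.
Qed.

(** A finite family in [S] whose span has maximal length spans [S], since adjoining a further
    element cannot enlarge the span. *)
Lemma klength_kspan V (S : V -> Prop) : has_klength V -> ksub S ->
  exists r (v : 'I_r -> V), (forall i, S (v i)) /\ incl S (kspan v).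
Proof.
move=> [mu muP] hS.
pose P (X : {r & 'I_r -> V}) := forall i, S (tagged X i).
have hT : ksub (fun _ : V => True) by [].
have [||[r v] [/= Sv maxv]] := @nat_argmax _ P
    (fun X => mu (kspan (tagged X))) (mu (fun=> True)).
- by exists (Tagged (fun r => 'I_r -> V) (fun i : 'I_0 => (0 : V))) => -[].
- by move=> X PX; apply: (muP _ _ (kspan_sub (tagged X)) hT _).1.
exists r, v; split=> // x Sx.
pose v' (i : 'I_r.+1) := oapp v x (unlift ord0 i).
have vv' : incl (kspan v) (kspan v').
  move=> _ [c ->]; exists (fun i => oapp c 0 (unlift ord0 i)).
  rewrite /kcomb big_ord_recl /v' unlift_none /= rmorph0 scale0r add0r.
  by apply: eq_bigr => i _; rewrite liftK.
apply: (muP _ _ (kspan_sub v) (kspan_sub v') vv').2 => //.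
  apply: (maxv (Tagged (fun r => 'I_r -> V) v')) => i.
  by rewrite /= /v'; case: (unlift ord0 i).
exists (fun i => oapp (fun=> 0) 1 (unlift ord0 i)).
rewrite /kcomb big_ord_recl /v' unlift_none /= rmorph1 scale1r big1 ?addr0 // => i _.
by rewrite liftK /= rmorph0 scale0r.
Qed.

End ScalarRestriction.

Section ArtinAlgebra.
Variable R : pzRingType.
Hypothesis R_artin : artin_algebra R.
Implicit Types U V W : lmodType R.

Definition has_length V : Prop := exists mu : (V -> Prop) -> nat,
  forall S T, is_submod S -> is_submod T -> incl S T ->
    (mu S <= mu T)%N /\ ((mu T <= mu S)%N -> incl T S).

Lemma fin_gen_kspan : exists (k : comPzRingType) (phi : {rmorphism k -> R}),
  (forall a x, GRing.comm (phi a) x) /\ forall V, fin_gen V ->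
    has_klength phi V.
Proof.
have [k [phi [k_art phiC [m [g gR]]]]] := R_artin.
exists k, phi; split=> // V [r [v vV]].
(* The generators of [R] over [k] times those of [V] over [R], indexed by pairs. *)
pose w (l : 'I_(#|{: 'I_r * 'I_m}|)) : V :=
  g (enum_val l).2 *: v (enum_val l).1.
apply: (@kspan_klength _ _ _ _ _ w) => // x.
have [c ->] := vV x.
have [d dE] := choice (fun i => gR (c i)).
exists (fun l => d (enum_val l).1 (enum_val l).2); rewrite /kcomb /w.
rewrite -(big_enum_val (fun (p : 'I_r * 'I_m) => phi (d p.1 p.2) *: (g p.2 *: v p.1))) /=.
rewrite -(pair_bigA _ (fun i j => phi (d i j) *: (g j *: v i))) /=.
by apply: eq_bigr => i _; rewrite {1}dE scaler_suml; apply: eq_bigr => j _; rewrite scalerA.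
Qed.

Lemma fin_gen_length V : fin_gen V -> has_length V.
Proof.
have [k [phi [_ kl]]] := fin_gen_kspan; move=> /kl[mu muP].
by exists mu => S T /(is_submod_ksub phi) hS /(is_submod_ksub phi); apply: muP.
Qed.

Lemma fin_gen_sub U V (i : {linear U -> V}) : injective i -> fin_gen V -> fin_gen U.
Proof.
have [k [phi [_ kl]]] := fin_gen_kspan; move=> i_inj /kl Vl.
have [r [v [Sv Ss]]] := klength_kspan Vl (is_submod_ksub phi (im_submod i)).
have [u uE] := choice Sv; exists r, u => x.
have [|c xE] := Ss (i x); first by exists x.
exists (fun j => phi (c j)); apply: i_inj; rewrite xE linear_sum.
by apply: eq_bigr => j _; rewrite linearZ uE.
Qed.

(** A functional is determined by its values on [a] generators of [V], so the dual is a
    [k]-submodule of ['rV[R]_a], which has finite [k]-length. *)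
Lemma dual_fin_gen V : fin_gen V ->
  exists b (f : 'I_b -> {linear V -> R^o}), forall g : {linear V -> R^o},
    exists c : 'I_b -> R, forall x, g x = \sum_i (f i x : R) * c i.
Proof.
have [k [phi [phiC kl]]] := fin_gen_kspan; move=> [a [v vV]].
have Fl := kl _ (free_fg R a).
pose S (y : 'rV[R]_a) := exists g : {linear V -> R^o}, forall i, y 0 i = g (v i).
have hS : ksub phi S.
  split=> [|e x y [g gE] [h hE]].
    by exists (\0 : {linear V -> R^o}) => i; rewrite mxE.
  have [|l lE] := @linear_of R V R^o (fun x => phi e * (g x : R) + h x).
    move=> b s t; rewrite !linearP mulrDr addrACA scalerDr.
    suff -> : phi e * (b *: g s : R^o) = b *: (phi e * (g s : R) : R^o) by [].
    by rewrite [LHS]mulrA phiC -mulrA.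
  by exists l => i; rewrite lE !mxE gE hE.
have [b [y [Sy Sspan]]] := klength_kspan Fl hS.
have [f fE] := choice Sy; exists b, f => g.
have [|c yE] := Sspan (\row_i g (v i)); first by exists g => i; rewrite mxE.
exists (fun i => phi (c i)) => x.
have [d ->] := vV x; rewrite linear_sum /=.
transitivity (\sum_j \sum_i (d j * (f i (v j) : R)) * phi (c i)).
  apply: eq_bigr => j _; rewrite linearZ.
  have := congr1 (fun z : 'rV_a => z 0 j) yE; rewrite mxE /kcomb summxE => ->.
  rewrite [LHS]mulr_sumr; apply: eq_bigr => i _.
  by rewrite mxE fE phiC mulrA.
rewrite exchange_big /=; apply: eq_bigr => i _.
by rewrite -mulr_suml linear_sum; congr (_ * _); apply: eq_bigr => j _; rewrite linearZ.
Qed.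

End ArtinAlgebra.

(** * Fitting's lemma and simple modules *)

Section Iterates.
Variable R : pzRingType.
Implicit Types S U V W : lmodType R.

Lemma iter_linear V (f : {linear V -> V}) n :
  exists g : {linear V -> V}, forall x, g x = iter n f x.
Proof.
elim: n => [|n [g gE]]; first by exists idfun.
by exists (f \o g) => x; rewrite /= gE.
Qed.

Lemma iter_conj U V (f : U -> V) (g : V -> U) n x :
  iter n.+1 (fun y => f (g y)) x = f (iter n (fun y => g (f y)) (g x)).
Proof. by elim: n x => //= n IHn x; rewrite IHn. Qed.

Lemma iter_fix (T : Type) (f : T -> T) n x : f x = x -> iter n f x = x.
Proof. by move=> fx; elim: n => //= n ->. Qed.

Lemma iter_id_on (T X : Type) (j : X -> T) (f : T -> T) n :
  (forall s, f (j s) = j s) -> forall s, iter n f (j s) = j s.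
Proof. by move=> fj s; apply: iter_fix. Qed.

Definition nilpotent_map V (f : V -> V) : Prop := exists n, forall x, iter n f x = 0.

(** The kernels of the iterates increase and their images decrease; finite length stops both
    chains. *)
Lemma iter_stable V (f : {linear V -> V}) : has_length V ->
  exists n, [/\ (0 < n)%N, forall x, iter (n + n) f x = 0 -> iter n f x = 0
    & forall x, exists y, iter n f x = iter (n + n) f y].
Proof.
move=> [mu muP].
have hK n : is_submod (fun x => iter n f x = 0).
  have [g gE] := iter_linear f n; have := ker_submod g.
  by under [fun x => g x = 0]funext => x do rewrite gE.
have hI n : is_submod (fun y => exists x, iter n f x = y).
  have [g gE] := iter_linear f n; have := im_submod g.
  suff -> : (fun y => exists x, g x = y) = (fun y => exists x, iter n f x = y) by [].
  by apply: funext => y; apply: propext; split=> -[x <-]; exists x; rewrite gE.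
have f0 n : iter n f 0 = 0 by elim: n => //= n ->; rewrite raddf0.
have hT : is_submod (fun _ : V => True) by [].
have KS n m : (n <= m)%N -> incl (fun x => iter n f x = 0) (fun x => iter m f x = 0).
  by move=> /subnK <- x; rewrite iterD => ->.
have IS n m : (n <= m)%N ->
    incl (fun y => exists x, iter m f x = y) (fun y => exists x, iter n f x = y).
  by move=> /subnKC <- _ [x <-]; exists (iter (m - n) f x); rewrite -iterD.
have [||n0 [_ max0]] := @nat_argmax nat (fun=> True)
    (fun n => mu (fun x => iter n f x = 0)) (mu (fun=> True)).
- by exists 0%N.
- by move=> n _; apply: (muP _ _ (hK n) hT _).1.
pose M := mu (fun=> True).
have [||n1 [_ max1]] := @nat_argmax nat (fun=> True)
    (fun n => M - mu (fun y => exists x, iter n f x = y))%N M.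
- by exists 0%N.
- by move=> n _; apply: leq_subr.
have leM n : (mu (fun y => exists x, iter n f x = y) <= M)%N.
  exact: (muP _ _ (hI n) hT _).1.
(* The successor makes [n] positive, as needed to pass from the [n]-th iterate back to [f]. *)
pose n := (n0 + n1).+1.
have n0n : (n0 <= n)%N by rewrite /n -addnS leq_addr.
have n1n : (n1 <= n)%N by rewrite /n -addSn leq_addl.
exists n; split=> // x.
  have le0 : (n0 <= n + n)%N by apply: leq_trans n0n (leq_addr _ _).
  have := (muP _ _ (hK n0) (hK (n + n)%N) (KS _ _ le0)).2 (max0 _ Logic.I) x.
  by move=> /[apply]; apply: KS.
have le1 : (n1 <= n + n)%N by apply: leq_trans n1n (leq_addr _ _).
have [||y yE] := (muP _ _ (hI (n + n)%N) (hI n1) (IS _ _ le1)).2 _ (iter n f x).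
- by have := max1 (n + n)%N Logic.I; rewrite leq_sub2lE.
- by apply: IS n1n _ _; exists x.
by exists y.
Qed.

(** For a stable exponent, [V] is the direct sum of the kernel and the image of the iterate, so one
    of them is zero. *)
Lemma fitting V (f : {linear V -> V}) : has_length V -> indecomposable V ->
  nilpotent_map f \/ bijective f.
Proof.
move=> /(@iter_stable _ f)[n [n_gt0 kern im]] [_ indec].
have [g gE] := iter_linear f n.
have [||K0|I0] := indec (mk_sub (ker_submod g)) (mk_sub (im_submod g)).
- move=> x /mk_subP gx /mk_subP[y yx]; rewrite -yx gE; apply: kern.
  by rewrite iterD -!gE yx gx.
- move=> x; have [y yE] := im x.
  exists (x - iter n f y), (iter n f y); split; last by rewrite subrK.
    by apply/mk_subP; rewrite linearB !gE -iterD yE subrr.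
  by apply/mk_subP; exists y; rewrite gE.
- right; apply: inj_surj_bij.
    apply: inj_ker0 => x fx; apply: K0; apply/mk_subP; rewrite gE.
    case: (n) n_gt0 => // m _; rewrite iterSr fx.
    by have [h hE] := iter_linear f m; rewrite -hE raddf0.
  move=> x; have [y yE] := im x.
  have {}yE : x - iter n f y = 0.
    by apply: K0; apply/mk_subP; rewrite gE -gE linearB !gE -iterD yE subrr.
  exists (iter n.-1 f y); rewrite -iterS prednK //.
  by apply/esym/eqP; rewrite -subr_eq0; apply/eqP.
- by left; exists n => x; apply: I0; apply/mk_subP; exists x; rewrite gE.
Qed.

Lemma fitting_iso U V (f : {linear U -> V}) (g : {linear V -> U}) :
  has_length U -> has_length V -> indecomposable U -> indecomposable V ->
  ~ nilpotent_map (fun x => g (f x)) -> isomorphic U V.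
Proof.
move=> lU lV iU iV nn.
have nn' : ~ nilpotent_map (fun y => f (g y)).
  move=> [n nE]; apply: nn; exists n.+1 => x.
  by rewrite (iter_conj g f) nE raddf0.
have [//|gf_bij] := fitting (g \o f) lU iU.
have [//|fg_bij] := fitting (f \o g) lV iV.
exists f; apply: inj_surj_bij.
  by move=> x y fxy; apply: (bij_inj gf_bij); rewrite /= fxy.
by case: fg_bij => h _ hK y; exists (g (h y)); apply: hK.
Qed.

(** * Simple modules and simple submodules *)

Definition simple_mod S : Prop := (exists x : S, x <> 0) /\
  forall T : S -> Prop, is_submod T -> (forall x, T x -> x = 0) \/ (forall x, T x).

Lemma simple_inj S V (f : {linear S -> V}) : simple_mod S ->
  (exists x, f x <> 0) -> injective f.
Proof.
move=> [_ simS] [x fx]; case: (simS _ (ker_submod f)) => [f0|f0].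
  exact: inj_ker0.
by case: fx; apply: f0.
Qed.

Lemma simple_surj S V (f : {linear V -> S}) : simple_mod S ->
  (exists x, f x <> 0) -> surjective f.
Proof.
move=> [_ simS] [x fx]; case: (simS _ (im_submod f)) => [f0|f0]; last exact: f0.
by case: fx; apply: f0; exists x.
Qed.

Lemma inj_nz U V (f : {linear U -> V}) x : injective f -> x <> 0 -> f x <> 0.
Proof. by move=> fi x0 fx; apply: x0; apply: fi; rewrite fx raddf0. Qed.

Lemma minimal_submod V (T : V -> Prop) : has_length V -> is_submod T ->
  (exists2 x, T x & x <> 0) ->
  exists M : V -> Prop, [/\ is_submod M, incl M T, exists2 x, M x & x <> 0
    & forall M', is_submod M' -> incl M' M -> (forall x, M' x -> x = 0) \/ incl M M'].
Proof.
move=> [mu muP] hT Tnz.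
pose P M := [/\ is_submod M, incl M T & exists2 x, M x & x <> 0].
have [||M [[hM MT Mnz] Mmax]] := @nat_argmax _ P (fun M => mu T - mu M)%N (mu T).
- by exists T; split.
- by move=> M _; apply: leq_subr.
exists M; split=> // M' hM' M'M.
have [M'0|nM'0] := EM (forall x, M' x -> x = 0); first by left.
right; apply: (muP _ _ hM' hM M'M).2.
have M'T : incl M' T by move=> x /M'M/MT.
have := Mmax M'; rewrite leq_sub2lE ?(muP _ _ hM hT MT).1 //; apply; split=> //.
by move/existsNP: nM'0 => [x /not_implyP[? ?]]; exists x.
Qed.

Lemma simple_sub V (T : V -> Prop) : has_length V -> is_submod T ->
  (exists2 x, T x & x <> 0) ->
  exists S (j : {linear S -> V}), [/\ simple_mod S, injective j & forall s, T (j s)].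
Proof.
move=> lV hT Tnz; have [M [hM MT [x Mx x0] Mmin]] := minimal_submod lV hT Tnz.
have [S [j [j_inj jE]]] := submodule_ex hM; exists S, j; split=> //.
  split.
    have [s sx] := (jE x).1 Mx; exists s => s0; apply: x0.
    by rewrite -sx s0 raddf0.
  move=> T' hT'; have [||M'0|MM'] := Mmin (fun y => exists2 s, T' s & j s = y).
  - split=> [|a _ _ [s T's <-] [t T't <-]]; first by exists 0; [case: hT'|rewrite raddf0].
    by exists (a *: s + t); rewrite ?linearP //; case: hT' => _; apply.
  - by move=> _ [s _ <-]; apply/jE; exists s.
  - left=> s T's; apply: j_inj; rewrite raddf0; apply: M'0; by exists s.
  - right=> s; have [|t T't] := MM' (j s); first by apply/jE; exists s.
    by move=> /j_inj <-.
by move=> s; apply: MT; apply/jE; exists s.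
Qed.

End Iterates.

(** * Vanishing of Ext *)

Section Ext.
Variable R : pzRingType.
Hypothesis R_artin : artin_algebra R.
Implicit Types A B M N P Q U V W : lmodType R.

(* Ext^(t+1)(A, M) = 0, computed from an injective coresolution (I, d) of M *)
Definition ext_vanish (I : nat -> lmodType R)
    (d : forall j, {linear I j -> I j.+1}) (t : nat) A : Prop :=
  forall g : {linear A -> I t.+1}, (forall x, d t.+1 (g x) = 0) ->
    exists h : {linear A -> I t}, forall x, d t (h x) = g x.

(** Projectivity refers to surjections of finitely generated modules, so the lift goes through the
    image of [f], which is finitely generated as a submodule of [V]. *)
Lemma proj_lift_exact Q U V W (f : {linear U -> V}) (g : {linear V -> W})
    (a : {linear Q -> V}) :
  projective_mod Q -> fin_gen U -> fin_gen V -> exact_at f g ->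
  (forall x, g (a x) = 0) -> exists h : {linear Q -> U}, forall x, f (h x) = a x.
Proof.
move=> pQ fU fV fg ga.
have [Z [z [z_inj zE]]] := submodule_ex (im_submod f).
have fZ : fin_gen Z by apply: (fin_gen_sub R_artin z_inj).
have [f' f'E] : exists f' : {linear U -> Z}, forall x, z (f' x) = f x.
  by apply: (linear_lift z_inj) => x; apply/zE; exists x.
have [a' a'E] : exists a' : {linear Q -> Z}, forall x, z (a' x) = a x.
  by apply: (linear_lift z_inj) => x; apply/zE/fg.
have [|h hE] := pQ _ _ f' a' fU fZ.
  move=> y; have [x xy] : exists x, f x = z y by apply/zE; exists y.
  by exists x; apply: z_inj; rewrite f'E.
by exists h => x; rewrite -f'E hE a'E.
Qed.

Section Coresolution.
Variables (M : lmodType R) (I : nat -> lmodType R) (e : {linear M -> I 0%N})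
  (d : forall j, {linear I j -> I j.+1}).
Hypothesis (fM : fin_gen M) (res : injective_coresolution e d).

Let fI j : fin_gen (I j). Proof. by case: res => /(_ j)[]. Qed.
Let iI j : injective_mod (I j). Proof. by case: res => /(_ j)[]. Qed.
Let e_inj : injective e. Proof. by case: res. Qed.
Let e_d : exact_at e (d 0%N). Proof. by case: res. Qed.
Let d_d j : exact_at (d j) (d j.+1). Proof. by case: res => _ _ _ /(_ j). Qed.

Lemma coresolution_dd j x : d j.+1 (d j x) = 0.
Proof. by apply/d_d; exists x. Qed.

Lemma ext_vanish_proj t Q : projective_mod Q -> ext_vanish d t Q.
Proof. by move=> pQ g gd; apply: (proj_lift_exact pQ _ _ (@d_d t)). Qed.

Section Shift.
Variables (U Q A : lmodType R) (i : {linear U -> Q}) (p : {linear Q -> A}).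
Hypotheses (fU : fin_gen U) (fQ : fin_gen Q) (iQA : ses i p).

Let i_inj : injective i. Proof. by case: iQA. Qed.
Let p_surj : surjective p. Proof. by case: iQA. Qed.
Let pi0 u : p (i u) = 0. Proof. by case: iQA => _ _ E; apply/E; exists u. Qed.
Let pK y : p y = 0 -> exists u, i u = y. Proof. by case: iQA => _ _ E /E. Qed.

(** An extension of [e \o g] to [Q] is corrected by a map coming from [A] until it takes values in
    [M]. *)
Lemma ext_vanish0_extends : projective_mod Q -> ext_vanish d 0 A ->
  forall g : {linear U -> M}, exists h : {linear Q -> M}, forall u, h (i u) = g u.
Proof.
move=> pQ vA g; have [k kE] := iI (e \o g) fU fQ i_inj.
have [|a aE] := @linear_factor _ _ _ _ p (d 0%N \o k) p_surj.
  by move=> y /pK[u <-]; rewrite /= kE /=; apply/e_d; exists (g u).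
have [|h hE] := vA a.
  by move=> x; have [y <-] := p_surj x; rewrite aE coresolution_dd.
have [|l lE] := @linear_lift _ _ _ _ e (k \- (h \o p)) e_inj.
  by move=> y; apply/e_d; rewrite /= linearB hE aE subrr.
exists l => u; apply: e_inj; rewrite lE /= pi0 raddf0 subr0; exact: kE.
Qed.

Lemma extends_ext_vanish0 : ext_vanish d 0 Q ->
  (forall g : {linear U -> M}, exists h : {linear Q -> M}, forall u, h (i u) = g u) ->
  ext_vanish d 0 A.
Proof.
move=> vQ ext a ad; have [|h hE] := vQ (a \o p); first by move=> x; apply: ad.
have [|g gE] := @linear_lift _ _ _ _ e (h \o i) e_inj.
  by move=> u; apply/e_d; rewrite /= hE /= pi0 raddf0.
have [l lE] := ext g.
have [|b bE] := @linear_factor _ _ _ _ p (h \- (e \o l)) p_surj.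
  by move=> y /pK[u <-]; rewrite /= lE gE subrr.
exists b => x; have [y <-] := p_surj x.
rewrite bE /= linearB hE; have -> : d 0%N (e (l y)) = 0 by apply/e_d; exists (l y).
by rewrite subr0.
Qed.

(** Dimension shift: an extension of [g] to [Q] is corrected to a cocycle by a map coming from [A],
    then lifted by projectivity of [Q]. *)
Lemma ext_vanish_syzygy t : projective_mod Q -> ext_vanish d t.+1 A -> ext_vanish d t U.
Proof.
move=> pQ vA g gd; have [k kE] := iI g fU fQ i_inj.
have [|a aE] := @linear_factor _ _ _ _ p (d t.+1 \o k) p_surj.
  by move=> y /pK[u <-]; rewrite /= kE gd.
have [|h hE] := vA a.
  by move=> x; have [y <-] := p_surj x; rewrite aE coresolution_dd.
have [| | | |l lE] := @proj_lift_exact _ _ _ _ (d t) (d t.+1) (k \- (h \o p)) pQ.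
- exact: fI.
- exact: fI.
- exact: d_d.
- by move=> y; rewrite /= linearB hE aE subrr.
- by exists (l \o i) => u; rewrite /= lE /= pi0 raddf0 subr0.
Qed.

Lemma ext_vanish_cosyzygy t : ext_vanish d t.+1 Q -> ext_vanish d t U ->
  ext_vanish d t.+1 A.
Proof.
move=> vQ vU a ad; have [|h hE] := vQ (a \o p); first by move=> x; apply: ad.
have [|g gE] := vU (h \o i); first by move=> u; rewrite /= hE /= pi0 raddf0.
have [l lE] := iI g fU fQ i_inj.
have [|b bE] := @linear_factor _ _ _ _ p (h \- (d t \o l)) p_surj.
  by move=> y /pK[u <-]; rewrite /= lE gE subrr.
exists b => x; have [y <-] := p_surj x.
by rewrite bE /= linearB hE coresolution_dd subr0.
Qed.

End Shift.

Lemma ext_vanish_zero t A : zero_mod (I t.+1) -> ext_vanish d t A.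
Proof.
move=> z g _; have [h hE] : exists h : {linear A -> I t}, forall x, h x = 0.
  by apply: linear_of => a x y; rewrite scaler0 addr0.
by exists h => x; rewrite hE raddf0 (z (g x)).
Qed.

Lemma ext_vanish_iso t A B (f : {linear A -> B}) : bijective f ->
  ext_vanish d t A -> ext_vanish d t B.
Proof.
move=> /linear_inv[f' [fK f'K]] vA g gd.
have [|h hE] := vA (g \o f); first by move=> x; apply: gd.
by exists (h \o f') => x; rewrite /= hE /= f'K.
Qed.

End Coresolution.

Lemma free_ses A : fin_gen A -> exists (m : nat) U (i : {linear U -> 'rV[R]_m})
  (p : {linear 'rV[R]_m -> A}), fin_gen U /\ ses i p.
Proof.
move=> /free_cover[m [p p_surj]]; have [U [i ip]] := ses_ker p_surj.
exists m, U, i, p; split=> //; case: ip => i_inj _ _.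
exact: (fin_gen_sub R_artin i_inj) (free_fg _ _).
Qed.

(** Dimension shift reduces to Ext^1, whose vanishing means that maps from a syzygy to [M] extend, a
    condition free of the coresolution. *)
Lemma ext_vanish_indep M (I I' : nat -> lmodType R) (e : {linear M -> I 0%N})
    (e' : {linear M -> I' 0%N}) (d : forall j, {linear I j -> I j.+1})
    (d' : forall j, {linear I' j -> I' j.+1}) t A :
  fin_gen M -> injective_coresolution e d -> injective_coresolution e' d' ->
  fin_gen A -> ext_vanish d t A -> ext_vanish d' t A.
Proof.
move=> fM res res'; elim: t A => [|t IHt] A /free_ses[m [U [i [p [fU ip]]]]] vA.
all: have pQ := @free_proj R m; have fQ := free_fg R m.
all: have vQ := fun t => ext_vanish_proj res' (t := t) pQ.
  apply: (extends_ext_vanish0 res' ip (vQ _)).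
  exact: (ext_vanish0_extends res fU fQ ip pQ vA).
apply: (ext_vanish_cosyzygy res' fU fQ ip (vQ _)); apply: IHt => //.
exact: (ext_vanish_syzygy res fU fQ ip pQ vA).
Qed.

End Ext.

(** * Gorenstein projective modules *)

Section Gorenstein.
Variable R : pzRingType.
Hypothesis R_artin : artin_algebra R.
Implicit Types A B G M N P Q U V W : lmodType R.

Lemma gorenstein_syzygy G : gorenstein_projective G ->
  exists U Q (i : {linear U -> Q}) (p : {linear Q -> G}),
    [/\ ses i p, gorenstein_projective U, fin_gen Q, projective_mod Q
      & forall g : {linear U -> R^o}, exists h : {linear Q -> R^o},
          forall u, h (i u) = g u].
Proof.
move=> [P [d [[fpP ex hom] [i [f [f_inj fE]]]]]].
(* With this index, [G] is the image of [d (l + 1 + 1)], its syzygy [U] that of [d (l + 1)], and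
   exactness of the dual complex is used at [l]. *)
have [l il] : exists l : int, i = l + 1 + 1.
  by exists (i - 1 - 1); rewrite !subrK.
subst i; have [p pE] : exists p : {linear P (l + 1 + 1) -> G},
    forall x, f (p x) = d (l + 1 + 1) x.
  by apply: (linear_lift f_inj) => x; apply/fE; exists x.
have p_surj : surjective p.
  move=> y; have [x xy] := (fE (f y)).1 (ex_intro _ y erefl).
  by exists x; apply: f_inj; rewrite pE.
have [U [u up]] := ses_ker p_surj; have [u_inj _ uE] := up.
have p0 x : p x = 0 <-> d (l + 1 + 1) x = 0.
  rewrite -pE; split=> [->|fp]; first by rewrite raddf0.
  by apply: f_inj; rewrite fp raddf0.
exists U, (P (l + 1 + 1)), u, p; split=> //; try by case: (fpP (l + 1 + 1)).
  exists P, d; split; first by split.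
  exists (l + 1), u; split=> // y.
  by rewrite -(uE y) p0; apply: ex.
move=> g; have [c cE] : exists c : {linear P (l + 1) -> U}, forall x, u (c x) = d (l + 1) x.
  by apply: (linear_lift u_inj) => x; apply/uE/p0/ex; exists x.
have c_surj : surjective c.
  move=> y; have /uE/p0/ex[x xy] : exists z, u z = u y by exists y.
  by exists x; apply: u_inj; rewrite cE.
have [|h hE] := (hom l (g \o c)).1.
  move=> x /=; have -> : c (d l x) = 0; last by rewrite raddf0.
  by apply: u_inj; rewrite cE raddf0; apply/ex; exists x.
by exists h => v; have [y <-] := c_surj v; rewrite cE hE.
Qed.

Lemma gorenstein_fin_gen G : gorenstein_projective G -> fin_gen G.
Proof.
move=> /gorenstein_syzygy[U [Q [i [p [[_ ps _] _ fQ _ _]]]]].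
exact: fin_gen_im ps fQ.
Qed.

Section Coresolution.
Variables (I : nat -> lmodType R) (e : {linear R^o -> I 0%N})
  (d : forall j, {linear I j -> I j.+1}).
Hypothesis res : injective_coresolution e d.

Lemma gorenstein_ext_vanish t G : gorenstein_projective G -> ext_vanish d t G.
Proof.
elim: t G => [|t IHt] G /gorenstein_syzygy[U [Q [i [p [ip gU fQ pQ ext]]]]].
  exact: (extends_ext_vanish0 res ip (ext_vanish_proj R_artin res pQ)).
have fU := gorenstein_fin_gen gU.
exact: (ext_vanish_cosyzygy res fU fQ ip (ext_vanish_proj R_artin res pQ) (IHt _ gU)).
Qed.

(** Induction on the length of the resolution, passing to the kernel of its augmentation. The index
    [t] stands for Ext^(t+1), whence [m <= t]. *)
Lemma gpd_ext_vanish m t N : (m <= t)%N -> Gpd_le N m -> ext_vanish d t N.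
Proof.
elim: m t N => [|m IHm] t N mt [G [e' [d' [gG es d0e dd zG]]]].
  apply: (ext_vanish_iso (f := e') _ (gorenstein_ext_vanish (gG 0%N))).
  apply: inj_surj_bij => //; apply: inj_ker0 => x /d0e[y <-].
  by rewrite (zG 1%N isT y) raddf0.
case: t mt => // t mt.
have [U [i ie]] := ses_ker es; have [i_inj _ iE] := ie.
have fG := gorenstein_fin_gen (gG 0%N).
have fU := fin_gen_sub R_artin i_inj fG.
apply: (ext_vanish_cosyzygy res fU fG ie (gorenstein_ext_vanish (gG 0%N))).
apply: IHm => //; have [e1 e1E] : exists e1 : {linear G 1%N -> U}, forall x, i (e1 x) = d' 0%N x.
  by apply: (linear_lift i_inj) => x; apply/iE/d0e; exists x.
exists (fun j => G j.+1), e1, (fun j => d' j.+1); split=> //.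
- move=> y; have /iE/d0e[x xy] : exists u, i u = i y by exists y.
  by exists x; apply: i_inj; rewrite e1E.
- move=> y; rewrite -(dd 0%N y) -e1E; split=> [->|ie1]; first by rewrite raddf0.
  by apply: i_inj; rewrite ie1 raddf0.
- by move=> j mj; apply: zG.
Qed.

(** * Complete resolutions of modules left orthogonal to the regular module *)

Definition ext_perp A : Prop := fin_gen A /\ forall t, ext_vanish d t A.

(** One short exact piece of a totally acyclic complex; [link_ext] keeps it exact under Hom into
    [R^o]. *)
Record link A B := Link {
  link_mod : lmodType R;
  link_i : {linear A -> link_mod};
  link_p : {linear link_mod -> B};
  link_ses : ses link_i link_p;
  link_fg : fin_gen link_mod;
  link_proj : projective_mod link_mod;
  link_ext : forall g : {linear A -> R^o}, exists h : {linear link_mod -> R^o},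
    forall u, h (link_i u) = g u }.

Lemma link_prev B : ext_perp B -> exists A, ext_perp A /\ inhabited (link A B).
Proof.
move=> [fB vB]; have [m [U [i [p [fU ip]]]]] := free_ses R_artin fB.
have fQ := free_fg R m; have pQ := @free_proj R m.
exists U; split.
  by split=> // t; apply: (ext_vanish_syzygy R_artin res fU fQ ip pQ).
split; apply: (Link ip) => //.
exact: (ext_vanish0_extends res fU fQ ip pQ).
Qed.

Hypothesis embed : forall A, ext_perp A -> exists Q (i : {linear A -> Q}),
  [/\ fin_gen Q, projective_mod Q & injective i].

Lemma link_next A : ext_perp A -> exists B, ext_perp B /\ inhabited (link A B).
Proof.
move=> pA; have [fA vA] := pA; have [b [f fE]] := dual_fin_gen R_artin fA.
have [F FE] : exists F : {linear A -> 'rV[R]_b}, forall x, F x = \row_i f i x.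
  by apply: linear_of => a x y; apply/rowP => i; rewrite !mxE linearP.
have F_inj : injective F.
  have [Q [i [fQ pQ i_inj]]] := embed pA.
  have [c [q q_surj]] := free_cover fQ.
  (* The cover of [Q] splits, so [A] embeds in a free module; the coordinates of this embedding are
     combinations of the [f i] and vanish wherever [F] does. *)
  have [|s sE] := pQ _ _ q (idfun : {linear Q -> Q}) (free_fg _ _) fQ; first exact: q_surj.
  apply: inj_ker0 => x Fx; apply: i_inj; rewrite raddf0.
  suff si0 : s (i x) = 0 by rewrite -[i x]/(idfun (i x)) -(sE (i x)) si0 raddf0.
  apply/rowP => j; rewrite mxE.
  have [g gE] : exists g : {linear A -> R^o}, forall y, g y = s (i y) 0 j.
    by apply: linear_of => a y z; rewrite !linearP !mxE.
  rewrite -gE; have [w ->] := fE g; rewrite big1 // => l _.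
  have -> : f l x = 0 by have := congr1 (fun z : 'rV_b => z 0 l) Fx; rewrite FE !mxE.
  exact: mul0r.
have [B [p Fp]] := ses_coker F_inj.
have fQ := free_fg R b; have pQ := @free_proj R b.
have vQ t := ext_vanish_proj R_artin res (t := t) pQ.
have ext (g : {linear A -> R^o}) : exists h : {linear 'rV[R]_b -> R^o},
    forall u, h (F u) = g u.
  have [w wE] := fE g.
  have [h hE] := @free_map R R^o b w; exists h => u.
  by rewrite hE wE FE; apply: eq_bigr => j _; rewrite mxE.
exists B; split; last by split; apply: (Link Fp).
split; first by case: Fp => _ ps _; apply: fin_gen_im ps fQ.
case=> [|t]; first exact: (extends_ext_vanish0 res Fp).
exact: (ext_vanish_cosyzygy res fA fQ Fp).
Qed.

(** Consecutive links are spliced. The index [-1 + 1] fits the definition, which embeds the module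
    in a term of index [i + 1], here with [i = -1]. *)
Lemma gorenstein_of_links (A : int -> lmodType R) :
  (forall i, inhabited (link (A i) (A (i + 1)))) -> gorenstein_projective (A (-1 + 1)).
Proof.
move=> L.
have D i : link (A i) (A (i + 1)).
  by apply: (sval (cid (_ : exists _ : link (A i) (A (i + 1)), True))); case: (L i) => x; exists x.
pose P i := link_mod (D i).
pose dl i : {linear P i -> P (i + 1)} := link_i (D (i + 1)) \o link_p (D i).
have i_inj i : injective (link_i (D i)) by case: (link_ses (D i)).
have p_surj i : surjective (link_p (D i)) by case: (link_ses (D i)).
have ip i : exact_at (link_i (D i)) (link_p (D i)) by case: (link_ses (D i)).
have dE i x : dl i x = link_i (D (i + 1)) (link_p (D i) x) by [].
have im_d i y : (exists x, link_i (D (i + 1)) x = y) <-> (exists x, dl i x = y).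
  split=> [[a <-]|[x <-]]; last by exists (link_p (D i) x).
  by have [x <-] := p_surj i a; exists x.
have ker_d i y : dl i y = 0 <-> link_p (D i) y = 0.
  rewrite dE; split=> [iy|->]; last by rewrite raddf0.
  by apply: (@i_inj (i + 1)); rewrite iy raddf0.
have dd i : exact_at (dl i) (dl (i + 1)).
  by move=> y; rewrite ker_d -im_d; apply: ip.
exists P, dl; split; last first.
  by exists (-1), (link_i (D (-1 + 1))); split; [apply: i_inj|apply: im_d].
split=> // [i|i g]; first by split; [apply: link_fg|apply: link_proj].
split=> [gd|[h hE] x]; last first.
  by rewrite -hE; have -> := (dd i (dl i x)).2 (ex_intro _ x erefl); rewrite raddf0.
(* [g] descends to [A (i + 1 + 1)], from where it extends along the next link. *)
have [|g' g'E] := @linear_factor _ _ _ _ (link_p (D (i + 1))) g (p_surj _).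
  by move=> v /ip/im_d[x <-]; apply: gd.
have [h hE] := link_ext (D (i + 1 + 1)) g'.
by exists h => y; rewrite dE hE g'E.
Qed.

Lemma ext_perp_gorenstein A : ext_perp A -> gorenstein_projective A.
Proof.
move=> pA; pose T := {B | ext_perp B}.
have [nx nxP] := @choice T T (fun X Y => inhabited (link (sval X) (sval Y)))
  (fun '(exist B pB) => let '(ex_intro C (conj pC BC)) := link_next pB in
     ex_intro _ (exist _ C pC) BC).
have [pv pvP] := @choice T T (fun X Y => inhabited (link (sval Y) (sval X)))
  (fun '(exist B pB) => let '(ex_intro C (conj pC BC)) := link_prev pB in
     ex_intro _ (exist _ C pC) BC).
pose X0 : T := exist _ A pA.
(* [Negz m] is -(m + 1), hence the [m.+1] backward steps. *)
pose X (i : int) : T :=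
  match i with Posz m => iter m nx X0 | Negz m => iter m.+1 pv X0 end.
apply: (@gorenstein_of_links (fun i => sval (X i))) => -[m|[|m]].
- have -> : (m : int) + 1 = m.+1 by rewrite -addn1 PoszD.
  exact: nxP.
- exact: pvP.
- have -> : Negz m.+1 + 1 = Negz m by rewrite !NegzE -addn1 PoszD opprD addrNK.
  exact: pvP.
Qed.

Lemma proj_ext_perp Q : fin_gen Q -> projective_mod Q -> ext_perp Q.
Proof. by move=> fQ pQ; split=> // t; apply: (ext_vanish_proj R_artin res). Qed.

(** The [m]-th syzygy of [A] in a free resolution lies in [ext_perp], so it can end a Gorenstein
    projective resolution. *)
Lemma ext_vanish_gpd m A : fin_gen A -> (forall t, (m <= t)%N -> ext_vanish d t A) ->
  Gpd_le A m.
Proof.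
elim: m A => [|m IHm] A fA vA.
  pose G j : lmodType R := if j is _.+1 then 'rV[R]_0 else A.
  exists G, (idfun : {linear A -> A}), (fun j => \0 : {linear G j.+1 -> G j}).
  split=> //.
  - case=> [|j]; first by apply: ext_perp_gorenstein; split=> // t; apply: vA.
    by apply/ext_perp_gorenstein/proj_ext_perp; [apply: free_fg|apply: free_proj].
  - by move=> y; exists y.
  - by move=> y; split=> [yE|[x <-]] //; exists 0; rewrite -[RHS]/(idfun y) yE.
  - by move=> j y; split=> // _; exists 0; rewrite [y]thinmx0.
  - by case=> // j _ x; rewrite [x]thinmx0.
have [r [U [i [p [fU ip]]]]] := free_ses R_artin fA.
have fQ := free_fg R r; have pQ := @free_proj R r.
have [|G [e' [d' [gG es d0e dd zG]]]] := IHm U fU.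
  by move=> t mt; apply: (ext_vanish_syzygy R_artin res fU fQ ip pQ); apply: vA.
pose G' j : lmodType R := if j is j'.+1 then G j' else 'rV[R]_r.
pose dG j : {linear G' j.+1 -> G' j} :=
  match j return {linear G' j.+1 -> G' j} with 0%N => i \o e' | j'.+1 => d' j' end.
have [i_inj p_surj ipE] := ip.
exists G', p, dG; split=> //.
- case=> [|j]; last exact: gG.
  exact: (ext_perp_gorenstein (proj_ext_perp fQ pQ)).
- move=> y; rewrite ipE; split=> [[u <-]|[x <-]]; last by exists (e' x).
  by have [x <-] := es u; exists x.
- case=> [|j]; last exact: dd.
  move=> y; rewrite -(d0e y) /=; split=> [ie|->]; last by rewrite raddf0.
  by apply: i_inj; rewrite ie raddf0.
- by case=> // j mj; apply: zG.
Qed.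

End Coresolution.
End Gorenstein.

(** * Stable equivalence along projective-injective modules *)

Section Stable.
Variable R : pzRingType.
Hypothesis R_artin : artin_algebra R.
Implicit Types A B C E J P Q S U V W X : lmodType R.

Definition factors_prinj A B (u : A -> B) : Prop :=
  exists Q (a : {linear A -> Q}) (b : {linear Q -> B}),
    prinj Q /\ forall x, u x = b (a x).

(* rho relates endomorphisms of A and B that correspond to each other up to
   maps factoring through projective-injective modules. *)
Definition stable_corr A B (rho : (A -> A) -> (B -> B) -> Prop) : Prop :=
  [/\ forall u : {linear A -> A}, exists w : {linear B -> B}, rho u w,
      forall w : {linear B -> B}, exists u : {linear A -> A}, rho u w,
      rho id id,
      forall u w u' w', rho u w -> rho u' w' -> rho (u \o u') (w \o w')
    & forall u w, rho u w -> factors_prinj u <-> factors_prinj w].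

Definition stably_equiv A B : Prop := exists rho, @stable_corr A B rho.

Lemma stably_equiv_trans A B C : stably_equiv A B -> stably_equiv B C -> stably_equiv A C.
Proof.
move=> [r1 [lr1 rl1 id1 comp1 fp1]] [r2 [lr2 rl2 id2 comp2 fp2]].
exists (fun u x => exists w, r1 u w /\ r2 w x); split.
- by move=> u; have [w uw] := lr1 u; have [x wx] := lr2 w; exists x, w.
- by move=> x; have [w wx] := rl2 x; have [u uw] := rl1 w; exists u, w.
- by exists id.
- move=> u x u' x' [w [uw wx]] [w' [uw' wx']]; exists (w \o w').
  by split; [apply: comp1|apply: comp2].
- by move=> u x [w [/fp1 -> /fp2]].
Qed.

(** Endomorphisms of [A] and [B] correspond when some endomorphism of [E] induces both; it exists by
    injectivity of [E] on one side and projectivity on the other. *)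
Lemma ses_stably_equiv A E B (i : {linear A -> E}) (p : {linear E -> B}) :
  prinj E -> ses i p -> stably_equiv A B.
Proof.
move=> [fE pE iE] [i_inj p_surj ip].
have fA := fin_gen_sub R_artin i_inj fE; have fB := fin_gen_im p_surj fE.
have pi0 x : p (i x) = 0 by apply/ip; exists x.
exists (fun u w => exists v : {linear E -> E},
  (forall x, v (i x) = i (u x)) /\ (forall y, p (v y) = w (p y))); split.
- move=> u; have [v vE] := iE _ _ i (i \o u) fA fE i_inj.
  have [|w wE] := @linear_factor _ _ _ _ p (p \o v) p_surj.
    by move=> y /ip[x <-]; rewrite /= vE /= pi0.
  by exists w, v; split=> [x|y]; rewrite ?vE ?wE.
- move=> w; have [v vE] := pE _ _ p (w \o p) fE fB p_surj.
  have [|u uE] := @linear_lift _ _ _ _ i (v \o i) i_inj.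
    by move=> x; apply/ip; rewrite /= vE /= pi0 raddf0.
  by exists u, v; split=> [x|y]; rewrite ?uE ?vE.
- by exists idfun.
- move=> u w u' w' [v [vu vw]] [v' [vu' vw']]; exists (v \o v').
  by split=> [x|y] /=; rewrite ?vu' ?vu ?vw ?vw'.
- move=> u w [v [vu vw]]; split=> [[Q [a [b [prQ uE]]]]|[Q [a [b [prQ wE]]]]].
    (* After subtraction of [i \o b \o a'], [v] kills the image of [i] and still induces [w], which
       therefore factors through [E]. The converse is dual. *)
    have [fQ pQ iQ] := prQ; have [a' a'E] := iQ _ _ i a fA fE i_inj.
    have [|s sE] := @linear_factor _ _ _ _ p (v \- (i \o b \o a')) p_surj.
      by move=> y /ip[x <-]; rewrite /= vu a'E uE subrr.
    exists E, s, p; split=> // y; have [x <-] := p_surj y.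
    by rewrite sE -vw raddfB /= pi0; apply/esym/subr0.
  have [fQ pQ iQ] := prQ; have [b' b'E] := pQ _ _ p b fE fB p_surj.
  have [|r rE] := @linear_lift _ _ _ _ i (v \- (b' \o a \o p)) i_inj.
    by move=> x; apply/ip; rewrite raddfB /= b'E vw wE subrr.
  exists E, i, r; split=> // x; apply: i_inj.
  by rewrite rE /= pi0 !raddf0 addr0 vu.
Qed.

Lemma stable_corr_iter A B rho u w n : @stable_corr A B rho -> rho u w ->
  rho (iter n u) (iter n w).
Proof. by move=> [_ _ rid rcomp _] uw; elim: n => [|n IHn] //=; apply: rcomp IHn. Qed.

(** As [Q] is projective, [h] is [p \o s] for some [s] into [E]. The image of a stable iterate of
    [s \o p] meets the kernel of [p] in zero, hence is zero. *)
Lemma factors_prinj_nilpotent E J (p : {linear E -> J}) (h : J -> J) :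
  prinj E -> surjective p ->
  (forall S : E -> Prop, is_submod S -> (forall x, S x -> p x = 0 -> x = 0) ->
     forall x, S x -> x = 0) ->
  factors_prinj h -> nilpotent_map h.
Proof.
move=> [fE pE iE] p_surj ess [Q [a [b [[fQ pQ _] hE]]]].
have [b' b'E] := pQ _ _ p b fE (fin_gen_im p_surj fE) p_surj.
pose s : {linear J -> E} := b' \o a.
have {hE} -> : h = fun x => p (s x) by apply: funext => x; rewrite hE /= b'E.
have [n [n0 kern _]] := iter_stable (s \o p) (fin_gen_length R_artin fE).
have [g gE] := iter_linear (s \o p) n.
exists n.+1 => x; rewrite (iter_conj p s) -[iter n _ _]gE.
suff -> : g (s x) = 0 by rewrite raddf0.
apply: (ess _ (im_submod g)); last by exists (s x).
move=> _ [y <-]; rewrite !gE => py; apply: kern; rewrite iterD.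
case: (n) n0 py => // m _ py; rewrite iterSr /= py raddf0.
by have [f fE'] := iter_linear (s \o p) m; rewrite -fE' !raddf0.
Qed.

End Stable.

(** * Counting simple modules *)

Section Counting.
Variable R : pzRingType.
Hypothesis R_artin : artin_algebra R.
Implicit Types A B C E J P Q S U V W : lmodType R.

Lemma direct_decomposition_maps V (m : nat) (P : 'I_m -> submodClosed V) :
  direct_decomposition P ->
  exists (i : forall l, {linear submod (P l) -> V})
         (r : forall l, {linear V -> submod (P l)}),
    (forall l, cancel (i l) (r l)) /\ forall x, x = \sum_l i l (r l x).
Proof.
move=> [gen indep].
have [i iE] : {i : forall l, {linear submod (P l) -> V} | forall l x, i l x = val x}.
  have ex l : exists f : {linear submod (P l) -> V}, forall x, f x = val x.
    exact: linear_of.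
  by exists (fun l => sval (cid (ex l))) => l; apply: (svalP (cid (ex l))).
have [q qE] := choice (fun x => (fun '(ex_intro2 p Pp xp) => ex_intro _ p (conj Pp xp))
  (gen x) : exists p : 'I_m -> V, (forall l, p l \in P l) /\ x = \sum_l p l).
have q_uniq x p : (forall l, p l \in P l) -> x = \sum_l p l -> forall l, q x l = p l.
  move=> Pp xp l; apply/eqP; rewrite -subr_eq0; apply/eqP.
  pose D l : V := q x l - p l; apply: (indep D) => [l'|].
    by apply: (subB (is_submodP (P l'))); [apply: (qE x).1|apply: Pp].
  by rewrite sumrB -(qE x).2 -xp subrr.
have q_lin l : linear (fun x => q x l).
  move=> a x y; apply: (q_uniq _ (fun l => a *: q x l + q y l)) => [l'|].
    by apply: rpredD; [apply: rpredZ|]; apply: (qE _).1.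
  by rewrite big_split -scaler_sumr /= -(qE x).2 -(qE y).2.
have rex l : exists f : {linear V -> submod (P l)}, forall x, i l (f x) = q x l.
  have [f fE] := linear_of (q_lin l).
  have il_inj : injective (i l) by move=> x y; rewrite !iE => /val_inj.
  have [|h hE] := linear_lift (g := f) il_inj.
    move=> x; have Pq : q x l \in P l := (qE x).1 l.
    by exists (exist (fun y => y \in P l) _ Pq : submod (P l)); rewrite iE fE.
  by exists h => x; rewrite hE fE.
pose r l := sval (cid (rex l)).
have rE l x : i l (r l x) = q x l := svalP (cid (rex l)) x.
exists i, r; split=> [l y|x].
  apply: val_inj; rewrite -!iE rE iE.
  rewrite (q_uniq _ (fun j => if j == l then val y else 0)) ?eqxx // => [j|].
    by case: eqP => [->|_]; [apply: valP|apply: rpred0].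
  by rewrite -big_mkcond big_pred1_eq.
by rewrite {1}(qE x).2; apply: eq_bigr => l _; rewrite rE.
Qed.

Section Decomposition.
Variables (m : nat) (X : 'I_m -> lmodType R).
Variables (iX : forall i, {linear X i -> R^o}) (rX : forall i, {linear R^o -> X i}).
Hypothesis rXK : forall i, cancel (iX i) (rX i).
Hypothesis sumX : forall x, x = \sum_i iX i (rX i x).
Hypothesis X_indec : forall i, indecomposable (X i).
Hypothesis X_basic : forall i j, isomorphic (X i) (X j) -> i = j.

Let retX i : retract (X i) R^o. Proof. by exists (iX i), (rX i). Qed.
Let fX i : fin_gen (X i). Proof. exact: retract_fg (retX i) (reg_fg R). Qed.
Let pX i : projective_mod (X i). Proof. exact: retract_proj (retX i) (@reg_proj R). Qed.
Let lX i : has_length (X i). Proof. exact: (fin_gen_length R_artin (fX i)). Qed.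

Definition maps_nz A B : Prop := exists (f : {linear A -> B}) x, f x <> 0.

Lemma simple_top_ex S : simple_mod S -> exists i, maps_nz (X i) S.
Proof.
move=> [[s s0] _]; have [F FE] := reg_map s.
apply: contrapT => none; apply: s0.
have <- : F 1 = s by rewrite FE scale1r.
rewrite (sumX 1) linear_sum big1 // => i _; apply: contrapT => Fi.
by apply: none; exists i, (F \o iX i), (rX i 1).
Qed.

Lemma simple_fin_gen S : simple_mod S -> fin_gen S.
Proof.
move=> simS; have [i [f fnz]] := simple_top_ex simS.
exact: fin_gen_im (simple_surj simS fnz) (fX i).
Qed.

(** If the kernel of [f] is not in that of [f'], then [f'] lifts through it to an endomorphism of
    [X i] that is not nilpotent, as it preserves [f'], nor bijective, as [f] kills its image. *)
Lemma simple_top_iso S S' i : simple_mod S -> simple_mod S' ->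
  maps_nz (X i) S -> maps_nz (X i) S' -> exists f : {linear S -> S'}, bijective f.
Proof.
move=> simS simS' [f [x fx]] [f' [x' fx']].
have f_surj : surjective f by apply: simple_surj => //; exists x.
have [ff'|] := EM (forall y, f y = 0 -> f' y = 0).
  have [t tE] := linear_factor f_surj ff'; exists t.
  have tnz : exists y, t y <> 0 by exists (f x'); rewrite tE.
  by apply: inj_surj_bij; [apply: simple_inj|apply: simple_surj].
move=> /existsNP[y /not_implyP[fy f'y]]; exfalso.
have [K [k kf]] := ses_ker f_surj; have [k_inj _ kE] := kf.
have fK := fin_gen_sub R_artin k_inj (fX i).
have f'k_surj : surjective (f' \o k).
  by apply: simple_surj => //; have [z zy] := (kE y).1 fy; exists z; rewrite /= zy.
have [h hE] := pX f' fK (simple_fin_gen simS') f'k_surj.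
have [[n nil]|[g _ gK]] := fitting (k \o h) (lX i) (X_indec i).
  apply: fx'; have <- : f' (iter n (k \o h) x') = f' x'.
    by elim: (n) => //= l IHl; rewrite -IHl; apply: hE.
  by rewrite nil raddf0.
by apply: fx; rewrite -(gK x); apply/kE; exists (h (g x)).
Qed.

(** * Simple modules attached to the indecomposable projectives *)

Variables (E J : lmodType R) (p : {linear E -> J}).
Hypothesis prE : prinj E.
Hypothesis iJ : injective_mod J.
Hypothesis p_surj : surjective p.
Hypothesis ess : forall T : E -> Prop, is_submod T ->
  (forall x, T x -> p x = 0 -> x = 0) -> forall x, T x -> x = 0.
Variable rho : (R^o -> R^o) -> (J -> J) -> Prop.
Hypothesis rhoP : stable_corr rho.

Let fE : fin_gen E. Proof. by case: prE. Qed.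
Let fJ : fin_gen J. Proof. exact: fin_gen_im p_surj fE. Qed.

Let fp_nil (h : J -> J) : factors_prinj h -> nilpotent_map h.
Proof. exact: (factors_prinj_nilpotent R_artin prE p_surj ess). Qed.

Lemma fixed_not_factors S (j : {linear S -> J}) (h : J -> J) :
  simple_mod S -> injective j -> (forall s, h (j s) = j s) -> ~ factors_prinj h.
Proof.
move=> [[s s0] _] j_inj hj /fp_nil[n nil].
by apply: s0; apply: j_inj; rewrite raddf0 -(nil (j s)) iter_id_on.
Qed.

(* The second case says that S is a submodule of the (n+1)-st cosyzygy of X i:
   this cosyzygy is a direct summand of J, cut out by an endomorphism w that
   corresponds to an endomorphism of R factoring through X i. *)
Definition attached i S : Prop :=
  (injective_mod (X i) /\ exists j : {linear S -> X i}, injective j) \/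
  exists (j : {linear S -> J}) (b : {linear R^o -> X i}) (c : {linear X i -> R^o})
         (w : {linear J -> J}),
    [/\ injective j, rho (c \o b) w & forall s, w (j s) = j s].

Lemma attached_ex i : exists S, simple_mod S /\ attached i S.
Proof.
have simple_in V (T : V -> Prop) : fin_gen V -> is_submod T -> ~ (forall x, T x -> x = 0) ->
    exists S (j : {linear S -> V}), [/\ simple_mod S, injective j & forall s, T (j s)].
  move=> fV hT /existsNP[x /not_implyP[Tx x0]].
  by apply: simple_sub => //; [apply: fin_gen_length|exists x].
have [injXi|ninj] := EM (injective_mod (X i)).
  have [||S [j [simS j_inj _]]] := simple_in (X i) (fun=> True) (fX i) => //.
    move=> X0; have [[x /eqP]] := X_indec i; case; exact: X0.
  by exists S; split=> //; left; split=> //; exists j.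
have [rho_l rho_r rho_id rho_comp rho_fp] := rhoP.
(* [a] matches the idempotent of [X i] only up to projective-injectives; a stable iterate [g] of it
   still does, and is injective on its own image. *)
have [a aE] := rho_l (iX i \o rX i).
have [n [n0 kern _]] := iter_stable a (fin_gen_length R_artin fJ).
have [g gE] := iter_linear a n.
have iterE k : iter k.+1 (iX i \o rX i) = iX i \o rX i.
  by apply: funext => x; elim: k => // k IHk; rewrite iterS IHk /= rXK.
have eg : rho (iX i \o rX i) g.
  rewrite -(iterE n.-1) prednK //; have -> : (g : J -> J) = iter n a by apply: funext.
  exact: (stable_corr_iter _ rhoP).
(* If [g] were zero, the idempotent would factor through a projective-injective module and [X i]
   would be injective. *)
have [g0|gN0] := EM (forall y, (exists x, g x = y) -> y = 0).
  exfalso; apply: ninj.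
  have : factors_prinj g.
    exists E, (\0 : {linear J -> E}), p; split=> // x.
    by rewrite raddf0; apply: g0; exists x.
  move=> /(rho_fp _ _ eg)[Q [u [v [prQ uv]]]].
  have [_ _ iQ] := prQ; apply: (retract_inj _ iQ).
  by exists (u \o iX i), (rX i \o v) => y; rewrite /= -uv /= !rXK.
have [S [j [simS j_inj jg]]] := simple_in J _ fJ (im_submod g) gN0.
exists S; split=> //; right.
have gj_inj : injective (g \o j).
  apply: inj_ker0 => s /= gs; apply: j_inj; rewrite raddf0.
  have [y yE] := jg s; move: gs; rewrite -yE !gE -iterD; exact: kern.
(* Composing [g] with [z] makes it fix [S] pointwise. *)
have [z zE] := iJ j (simple_fin_gen simS) fJ gj_inj.
have [u uz] := rho_r z.
exists j, (rX i), (u \o iX i), (z \o g); split=> //.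
exact: (rho_comp _ _ _ _ uz eg).
Qed.

Lemma prinj_X i : injective_mod (X i) -> prinj (X i).
Proof. by split. Qed.

Lemma attached_uniq i i' S S' : simple_mod S -> simple_mod S' ->
  attached i S -> attached i' S' ->
  (exists f : {linear S -> S'}, bijective f) -> i = i'.
Proof.
(* Extending the embeddings in both directions would give an endomorphism of [J] that fixes [S0] and
   factors through [X i0]. *)
have mixed i0 S0 (j0 : {linear S0 -> X i0}) (j1 : {linear S0 -> J}) :
    simple_mod S0 -> injective_mod (X i0) -> injective j0 -> injective j1 -> False.
  move=> simS injX j0_inj j1_inj; have fS := simple_fin_gen simS.
  have [f fE0] := iJ j1 fS (fX i0) j0_inj.
  have [g gE] := injX _ _ j1 j0 fS fJ j1_inj.
  apply: (fixed_not_factors (h := f \o g) simS j1_inj) => [s|].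
    by rewrite /= gE fE0.
  by exists (X i0), g, f; split=> //; apply: prinj_X.
move=> simS simS' aS aS' [f f_bij]; have [f' [fK f'K]] := linear_inv f_bij.
have f_inj := bij_inj f_bij.
have fS := simple_fin_gen simS; have fS' := simple_fin_gen simS'.
case: aS => [[injX [j j_inj]]|[j [b [c [w [j_inj cbw wj]]]]]];
  case: aS' => [[injX' [j' j'_inj]]|[j' [b' [c' [w' [j'_inj cbw' wj']]]]]].
- have [h hE] := injX' _ _ j (j' \o f) fS (fX i) j_inj.
  have [h' h'E] := injX _ _ j' (j \o f') fS' (fX i') j'_inj.
  apply: X_basic; apply: (fitting_iso (lX i) (lX i') (X_indec i) (X_indec i') (f := h) (g := h')).
  move=> [n nil]; have [[s s0] _] := simS; apply: s0; apply: j_inj.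
  rewrite raddf0 -(nil (j s)) (iter_id_on (j := j)) // => t.
  by rewrite hE h'E /= fK.
- exfalso; apply: (mixed i S j (j' \o f)) => // x y /j'_inj; exact: f_inj.
- exfalso; apply: (mixed i' S' j' (j \o f')) => // x y /j_inj.
  exact: (can_inj f'K).
have [_ rho_r _ rho_comp rho_fp] := rhoP.
have [h hE] := iJ (j' \o f) fS fJ j_inj.
have [h' h'E] := iJ (j \o f') fS' fJ j'_inj.
have [y yh] := rho_r h'; have [z zh] := rho_r h.
(* For distinct indices the composite through [X i] and [X i'] is nilpotent, so an iterate of [u] is
   zero; its counterpart on [J] then factors through a projective-injective, yet fixes [S]. *)
apply: contrapT => ii'.
have [n nil] : nilpotent_map (fun x => (b \o y \o c') ((b' \o z \o c) x)).
  apply: contrapT => nn; apply: ii'; apply: X_basic.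
  exact: (fitting_iso (lX i) (lX i') (X_indec i) (X_indec i') nn).
pose u := (c \o b) \o (y \o ((c' \o b') \o z)).
have uw : rho u (w \o (h' \o (w' \o h))).
  by apply: (rho_comp _ _ _ _ cbw); apply: (rho_comp _ _ _ _ yh); apply: (rho_comp _ _ _ _ cbw').
have u0 x : iter n.+1 u x = 0.
  rewrite (iter_conj c (b \o (y \o (c' \o (b' \o z))))).
  by rewrite (_ : iter n _ _ = 0) ?raddf0 //; apply: nil.
have uwn := stable_corr_iter n.+1 rhoP uw.
apply: (fixed_not_factors (h := iter n.+1 (w \o (h' \o (w' \o h)))) simS j_inj).
  move=> s; apply: iter_id_on => {}s.
  by rewrite /= hE /= wj' h'E /= fK wj.
apply/(rho_fp _ _ uwn).
exists E, (\0 : {linear R^o -> E}), (\0 : {linear E -> R^o}).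
by split=> // x; rewrite u0.
Qed.

(** Sending [i] to the index of a projective that maps onto its attached simple is injective on a
    finite set, hence onto; so every simple is isomorphic to an attached one. *)
Lemma simple_embeds S : simple_mod S ->
  (exists Q (j : {linear S -> Q}), prinj Q /\ injective j) \/
  (exists j : {linear S -> J}, injective j).
Proof.
move=> simS; have [T TP] := choice attached_ex.
have [s sP] := choice (fun i => simple_top_ex (TP i).1).
have s_inj : injective s.
  move=> i i' sii'; apply: (attached_uniq (TP i).1 (TP i').1 (TP i).2 (TP i').2).
  apply: (simple_top_iso (TP i).1 (TP i').1 (sP i)); rewrite sii'; exact: sP.
have [t tS] := simple_top_ex simS.
have [s' s'K sK'] := injF_bij s_inj.
have [f f_bij] : exists f : {linear S -> T (s' t)}, bijective f.
  by apply: (simple_top_iso simS (TP _).1 tS); rewrite -{1}(sK' t); apply: sP.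
have f_inj := bij_inj f_bij.
case: (TP (s' t)).2 => [[injX [j j_inj]]|[j [_ [_ [_ [j_inj _ _]]]]]].
  left; exists (X (s' t)), (j \o f); split; first exact: prinj_X.
  by move=> x y /j_inj/f_inj.
by right; exists (j \o f) => x y /j_inj/f_inj.
Qed.

End Decomposition.
End Counting.

(** * Embedding into projective-injective modules *)

Section Conclusion.
Variable R : pzRingType.
Hypothesis R_artin : artin_algebra R.
Implicit Types A B C E J P Q S U V W X Z : lmodType R.

Section Embedding.
Variables (E J : lmodType R) (p : {linear E -> J}).
Hypotheses (prE : prinj E) (iJ : injective_mod J).
Hypothesis simpleJ : forall S, simple_mod S ->
  (exists Q (j : {linear S -> Q}), prinj Q /\ injective j) \/
  (exists j : {linear S -> J}, injective j).

(* A map to a projective-injective module with minimal kernel is injective: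
   a simple submodule of the kernel could be separated by a further map. *)
Lemma prinj_embedding X : fin_gen X ->
  (forall g : {linear X -> J}, exists h : {linear X -> E}, forall x, p (h x) = g x) ->
  exists Q (f : {linear X -> Q}), prinj Q /\ injective f.
Proof.
move=> fX lift; have lX := fin_gen_length R_artin fX; have [mu muP] := lX.
pose T := {Q : lmodType R & {linear X -> Q}}.
pose K (y : T) : X -> Prop := fun x => projT2 y x = 0.
have hT : is_submod (fun _ : X => True) by [].
have hK y : is_submod (K y) := ker_submod (projT2 y).
have muT y : (mu (K y) <= mu (fun=> True))%N by apply: (muP _ _ (hK y) hT _).1.
have [||[Q f] [/= prQ fmax]] := @nat_argmax T (fun y => prinj (projT1 y))
    (fun y => mu (fun=> True) - mu (K y))%N (mu (fun=> True)).
- by exists (existT _ E (\0 : {linear X -> E})).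
- by move=> y _; apply: leq_subr.
exists Q, f; split=> //; apply: inj_ker0; apply: contrapT.
move=> /existsNP[x0 /not_implyP[fx0 x0N0]].
have [|S [j [simS j_inj fj]]] := simple_sub lX (ker_submod f).
  by exists x0.
have fS := fin_gen_sub R_artin j_inj fX; have [[s s0] _] := simS.
(* The embedding of [S] extends to [X]; an extension with values in [J] is then lifted to [E]. *)
have [Q' [g [prQ' gs]]] : exists Q' (g : {linear X -> Q'}), prinj Q' /\ g (j s) <> 0.
  case: (simpleJ simS) => [[Q' [j' [prQ' j'_inj]]]|[j' j'_inj]].
    have [_ _ iQ'] := prQ'; have [g gE] := iQ' _ _ j j' fS fX j_inj.
    by exists Q', g; split=> //; rewrite gE; apply: inj_nz.
  have [l lE] := iJ j' fS fX j_inj; have [h hE] := lift l.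
  exists E, h; split=> // hs; apply: (inj_nz j'_inj s0).
  by rewrite -lE -hE hs raddf0.
have [q qE] := pairing f g.
pose y' : T := existT (fun W : lmodType R => {linear X -> W}) (Q * Q')%type q.
have KK : incl (K y') (K (existT _ Q f)).
  by move=> x; rewrite /K /= qE => -[].
have := fmax y' (prinj_prod prQ prQ'); rewrite leq_sub2lE; last exact: muT.
move=> /((muP _ _ (hK _) (hK _) KK).2) /(_ (j s) (fj s)).
by rewrite /K /= qE => -[_ /gs].
Qed.

End Embedding.

(** [Z] is the cosyzygy of order [t + 1], reached by one use of [ses_stably_equiv] per term. *)
Lemma cosyzygy_stably_equiv (I : nat -> lmodType R) (e : {linear R^o -> I 0%N})
    (d : forall j, {linear I j -> I j.+1}) t :
  injective_coresolution e d -> (forall j, (j <= t)%N -> prinj (I j)) ->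
  exists Z (z : {linear Z -> I t.+1}),
    [/\ injective z, exact_at z (d t.+1) & stably_equiv R^o Z].
Proof.
move=> res prI; have [_ e_inj ed dd] := res.
have step j (Z : lmodType R) (z : {linear Z -> I j}) : injective z -> exact_at z (d j) -> prinj (I j) ->
    exists (Z' : lmodType R) (z' : {linear Z' -> I j.+1}),
    [/\ injective z', exact_at z' (d j.+1) & stably_equiv Z Z'].
  move=> z_inj zd prj.
  have [Z' [z' [z'_inj z'E]]] := submodule_ex (ker_submod (d j.+1)).
  have [|p pE] := linear_lift (g := d j) z'_inj.
    by move=> x; apply/z'E/dd; exists x.
  exists Z', z'; split=> //; apply: (ses_stably_equiv R_artin (i := z) (p := p) prj).
  split=> // [y|x].
    have /z'E/dd[x xy] : exists u, z' u = z' y by exists y.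
    by exists x; apply: z'_inj; rewrite pE.
  rewrite -(zd x) -pE; split=> [->|px]; first by rewrite raddf0.
  by apply: z'_inj; rewrite px raddf0.
elim: t prI => [|t IHt] prI; first by apply: (step 0%N R^o e) => //; apply: prI.
have [Z [z [z_inj zd RZ]]] : exists Z (z : {linear Z -> I t.+1}),
    [/\ injective z, exact_at z (d t.+1) & stably_equiv R^o Z].
  by apply: IHt => j jt; apply: prI; apply: leqW.
have [Z' [z' [z'_inj z'd ZZ']]] := step _ _ z z_inj zd (prI _ (leqnn _)).
by exists Z', z'; split=> //; apply: stably_equiv_trans RZ ZZ'.
Qed.

(** The inclusion of the image of [d n.+1] lifts to a map [s] into [I n.+1], whose image meets that
    of [d n] in zero and so vanishes by minimality. *)
Lemma coresolution_end (I : nat -> lmodType R) (e : {linear R^o -> I 0%N})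
    (d : forall j, {linear I j -> I j.+1}) n :
  minimal_injective_coresolution e d ->
  (forall A, fin_gen A -> ext_vanish d n.+1 A) -> forall x, d n.+1 x = 0.
Proof.
move=> [res _ ess] van x; have [fiI _ _ dd] := res.
have [A [z [z_inj zE]]] := submodule_ex (im_submod (d n.+1)).
have fA := fin_gen_sub R_artin z_inj (fiI n.+2).1.
have [|s sE] := van A fA z; first by move=> a; apply/dd/zE; exists a.
have s0 a : s a = 0.
  apply: (ess n (mk_sub (im_submod s))) => [u|]; last by apply/mk_subP; exists a.
  move=> /mk_subP[b sb]; rewrite -sb; suff -> : b = 0 by rewrite raddf0.
  apply: z_inj; rewrite raddf0 -sE sb; apply/dd; by exists u.
have /zE[a <-] : exists y, d n.+1 y = d n.+1 x by exists x.
by rewrite -sE s0 raddf0.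
Qed.

(** The socle is essential: a nonzero kernel contains a simple submodule. *)
Lemma socle_ker0 V W (f : {linear V -> W}) : fin_gen V ->
  (forall x, x \in @socle R V -> f x = 0 -> x = 0) -> injective f.
Proof.
move=> fV f0; apply: inj_ker0; apply: contrapT.
move=> /existsNP[x0 /not_implyP[fx0 x0N0]].
have [|M [hM Mf [x Mx xN0] Mmin]] := minimal_submod (fin_gen_length R_artin fV) (ker_submod f).
  by exists x0.
apply: (xN0); apply: f0; last exact: Mf.
apply/asboolP; exists [:: x]; first by rewrite big_seq1.
move=> v /[!inE] /eqP ->; exists (mk_sub hM); last exact/mk_subP.
split=> [|T TM].
  exists x; first exact/mk_subP.
  exact/eqP.
have [|T0|MT] := Mmin (fun y => y \in T) (is_submodP T).
- by move=> y /TM/mk_subP.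
- by left.
- by right=> y /mk_subP/MT.
Qed.

(** An extension of [f] to [V] stays injective because the socle is essential, and splits because
    [V] is injective. *)
Lemma prinj_of_socle V Q (f : {linear soc V -> Q}) : fin_gen V -> injective_mod V ->
  prinj Q -> injective f -> prinj V.
Proof.
move=> fV iV prQ f_inj; have [fQ pQ iQ] := prQ.
have [v vE] : exists v : {linear soc V -> V}, forall x, v x = val x.
  exact: linear_of.
have v_inj : injective v by move=> x y; rewrite !vE => /val_inj.
have fS := fin_gen_sub R_artin v_inj fV.
have [F FE] := iQ _ _ v f fS fV v_inj.
have F_inj : injective F.
  apply: socle_ker0 => // x sx Fx.
  pose y : soc V := exist _ x sx.
  have vy : v y = x by rewrite vE.
  rewrite -vy; have -> : y = 0; last by rewrite raddf0.
  by apply: f_inj; rewrite -FE vy Fx raddf0.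
have [r rE] := iV _ _ F (idfun : {linear V -> V}) fV fQ F_inj.
by apply: retract_prinj prQ; exists F, r.
Qed.

End Conclusion.

Theorem theorem3p2 (n : nat) (L : pzRingType) :
  (0 < n)%N ->
  basic_algebra L ->
  minimal_Auslander_Gorenstein L n ->
  forall I : lmodType L,
    prinj I <-> [/\ fin_gen I, injective_mod I & Gpd_le (soc I) n].
Proof.
(* As [n] is positive, [I n] receives the differential [d k], whose minimality makes the kernel of
   [d n] essential. *)
case: n => // k; set n := k.+1.
move=> _ [m [P [Pdec Pind Piso]]].
move=> [L_artin [I' [e' [d' [res' zI']]]] [I [e [d [min_res pI]]]]] V.
have [res _ ess] := min_res; have [fiI _ _ dd] := res.
have [i [r [rK sumP]]] := direct_decomposition_maps Pdec.
(* Ext^(n+2) vanishes when computed from [I'], which is zero beyond degree [n.+1]. *)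
have van A : fin_gen A -> ext_vanish d n.+1 A.
  move=> fA; apply: (ext_vanish_indep L_artin (reg_fg L) res' res fA).
  exact: ext_vanish_zero (zI' _ (leqnn _)).
have van_ge A t : fin_gen A -> (n < t)%N -> ext_vanish d t A.
  elim: t A => // t IHt A fA; rewrite ltnS leq_eqVlt => /orP[/eqP <-|nt]; first exact: van.
  have [a [U [u [p [fU up]]]]] := free_ses L_artin fA.
  apply: (ext_vanish_cosyzygy res fU (free_fg _ _) up); last exact: IHt.
  exact: (ext_vanish_proj L_artin res (@free_proj _ _)).
have dn0 := coresolution_end L_artin min_res van.
have dn_surj : surjective (d n) by move=> y; apply/dd.
have prI j : (j <= n)%N -> prinj (I j).
  by move=> jn; split; [apply: (fiI j).1|apply: pI|apply: (fiI j).2].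
have dn_ess (T : I n -> Prop) : is_submod T -> (forall x, T x -> d n x = 0 -> x = 0) ->
    forall x, T x -> x = 0.
  move=> hT T0 x Tx; apply: (ess k (mk_sub hT)); last exact/mk_subP.
  by move=> u /mk_subP Tu; apply: T0 => //; apply/dd; exists u.
(* The terms up to [I k] lead to the cosyzygy inside [I n]; a last step through [I n] reaches
   [I n.+1]. *)
have [rho rhoP] : stably_equiv L^o (I n.+1).
  have [Z [z [z_inj zd LZ]]] : exists (Z : lmodType L) (z : {linear Z -> I n}),
      [/\ injective z, exact_at z (d n) & stably_equiv L^o Z].
    by apply: (cosyzygy_stably_equiv L_artin res) => j jk; apply/prI/leqW.
  apply: (stably_equiv_trans LZ).
  exact: (ses_stably_equiv L_artin (prI n (leqnn n)) (And3 z_inj dn_surj zd)).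
have simpleJ (S : lmodType L) := @simple_embeds _ L_artin _ _ _ _ rK sumP Pind Piso _ _ _
  (prI n (leqnn n)) (fiI n.+1).2 dn_surj dn_ess _ rhoP S.
have emb X : fin_gen X -> ext_vanish d n X ->
    exists (Q : lmodType L) (f : {linear X -> Q}), prinj Q /\ injective f.
  move=> fX vX; apply: (prinj_embedding L_artin (prI n (leqnn n)) (fiI n.+1).2 simpleJ fX).
  by move=> g; apply: vX => x; apply: dn0.
have [v vE] : exists v : {linear soc V -> V}, forall x, v x = val x.
  exact: linear_of.
have v_inj : injective v by move=> x y; rewrite !vE => /val_inj.
split=> [prV|[fV iV gpdV]].
  have [fV pV iV] := prV; split=> //.
  have fS := fin_gen_sub L_artin v_inj fV.
  apply: (ext_vanish_gpd L_artin res) => // [A [fA vA]|t].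
    have [Q [f [[fQ pQ _] f_inj]]] := emb A fA (vA n).
    by exists Q, f.
  (* For [t = n], [g] extends to [V] because [I n.+1] is injective, and the extension lifts to [I n]
     because [V] is projective. *)
  rewrite leq_eqVlt => /orP[/eqP <- g _|nt]; last exact: van_ge.
  have [h hE] := (fiI n.+1).2 _ _ v g fS fV v_inj.
  have [h' h'E] := pV _ _ (d n) h (fiI n).1 (fiI n.+1).1 dn_surj.
  by exists (h' \o v) => x; rewrite /= h'E hE.
have fS := fin_gen_sub L_artin v_inj fV.
have [Q [f [prQ f_inj]]] := emb _ fS (gpd_ext_vanish L_artin res (leqnn n) gpdV).
exact: (prinj_of_socle L_artin fV iV prQ f_inj).
Qed.
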